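(* Let $\Lambda$ be a field and let $(M,\mu)$ be a graded commutative (associative) $\Lambda$-algebra such that $Harr^{n,2-n}(M,M)=0$ for all $n\geq 3$. Then any commutative $A(\infty)$-algebra structure $\{m_i\}_{i\ge1}$ on $M$ with $m_1=0$ and $m_2=\mu$ is equivalent (as a commutative $A(\infty)$-structure) to the trivial one, i.e. to the structure with $m_1=0$, $m_2=\mu$ and $m_i=0$ for all $i>2$.
   Context: Graded modules are $\mathbb{Z}$-graded $\Lambda$-modules $M=\sum_q M_q$; a graded associative algebra has a multiplication of degree $0$; graded commutative means $ab=(-1)^{\dim a\dim b}ba$. For graded modules $A,N$, $Hom^k(\otimes^nA,N)$ is the set of $\Lambda$-linear maps $f:\otimes^nA\to N$ of degree $k$, i.e. $f(a_1\otimes\dots\otimes a_n)\in N_{q+k}$ with $q=\sum\dim a_i$. Tensor products of maps are evaluated by the Koszul rule $(f\otimes g)(x\otimes y)=(-1)^{\deg g\cdot\dim x}f(x)\otimes g(y)$; $1$ denotes the identity map and $1^r=1^{\otimes r}$. Shuffles: for $n\ge 2$, $Sh^n(M)\subset\otimes^nM$ is the $\Lambda$-span of all elements $$\sum_\sigma \mathrm{sgn}(\sigma)\,\epsilon(\sigma)\,a_{\sigma(1)}\otimes\dots\otimes a_{\sigma(n)},\qquad 1\le k\le n-1,\ a_i\in M \text{ homogeneous},$$ where $\sigma$ runs over the permutations of $\{1,\dots,n\}$ with $\sigma^{-1}(1)<\dots<\sigma^{-1}(k)$ and $\sigma^{-1}(k+1)<\dots<\sigma^{-1}(n)$, and $\epsilon(\sigma)$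 is the Koszul sign (the transposition of $a\in M_p$ and $b\in M_q$ contributes $(-1)^{pq}$). Equivalently, after placing $a_i$ in degree $\dim a_i-1$ these are the signed shuffle products in the tensor coalgebra. Also $Sh^0(M)=Sh^1(M)=0$. Hochschild and Harrison cohomology: for a graded algebra $(A,\mu)$ put $C^{n,k}(A,A)=Hom^k(\otimes^nA,A)$, with coboundary $\delta:C^{n,k}(A,A)\to C^{n+1,k}(A,A)$, $$\delta f=\mu(1\otimes f)+\sum_{i=1}^{n}(-1)^i f(1^{i-1}\otimes\mu\otimes 1^{n-i})+(-1)^{n+1}\mu(f\otimes 1).$$ If $A$ is graded commutative, $\bar C^{n,k}(A,A)=\{f\in C^{n,k}(A,A): f|_{Sh^n(A)}=0\}$ is closed under $\delta$, and $Harr^{n,k}(A,A)$ is the $n$-th homology module of $(\bar C^{*,k}(A,A),\delta)$. An $A(\infty)$-algebra structure on a graded module $M$ is a sequence of $\Lambda$-linear maps $m_i:\otimes^iM\to M$, $i\ge1$, with $\deg m_i=2-i$, such that for every $n\ge1$ $$\sum_{r+s+t=n,\ s\ge1,\ r,t\ge 0}(-1)^{r+st}\,m_{r+1+t}(1^r\otimes m_s\otimes 1^t)=0.$$ A morphism of $A(\infty)$-algebras $(M,\{m_i\})\to(M',\{m'_i\})$ is a sequence of $\Lambda$-linear maps $f_i:\otimes^iM\to M'$, $i\ge1$, with $\deg f_i=1-i$, such that for every $n\ge 1$ $$\sum_{r+s+t=n,\ s\ge1,\ r,t\ge 0}(-1)^{r+st}f_{r+1+t}(1^r\otimes m_s\otimes1^t)=\sum_{u=1}^n\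 \sum_{k_1+\dots+k_u=n,\ k_l\ge1}(-1)^{\sum_{l=1}^u(u-l)(k_l-1)}\,m'_u(f_{k_1}\otimes\dots\otimes f_{k_u}).$$ The $A(\infty)$-structure is commutative if $m_i|_{Sh^i(M)}=0$ for all $i$; a morphism of commutative $A(\infty)$-algebras is a morphism of $A(\infty)$-algebras with $f_i|_{Sh^i(M)}=0$ for all $i$. Two commutative $A(\infty)$-structures $\{m_i\}$, $\{m'_i\}$ on $M$ with $m_1=m'_1=0$, $m_2=m'_2=\mu$ are equivalent if there is a morphism of commutative $A(\infty)$-algebras $\{p_i\}:(M,\{m_i\})\to(M,\{m'_i\})$ with $p_1=\mathrm{id}$. *)

(* Defs.v *)
From HB Require Import structures.
From mathcomp Require Import all_boot all_order all_algebra all_fingroup.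

Set Implicit Arguments.
Unset Strict Implicit.
Unset Printing Implicit Defensive.

Import Order.TTheory GRing.Theory Num.Theory.
Local Open Scope ring_scope.

(* A Z-graded K-module is given by its total module together with the
   projections x |-> x_q onto the homogeneous components: orthogonal idempotents
   such that each x is a finite sum of its components x_q. The submodule M_q is
   the image of [hpart q]. *)
Record gradedModule (K : fieldType) := GradedModule {
  gmod :> lmodType K;
  hpart : int -> {linear gmod -> gmod};
  hpart_orth : forall (p q : int) (x : gmod),
    hpart p (hpart q x) = if p == q then hpart q x else 0;
  hpart_sum : forall x : gmod,
    exists s : seq int, uniq s && (x == \sum_(q <- s) hpart q x)
}.

Section GradedMaps.
Context {K : fieldType}.
Implicit Types M N : gradedModule K.

(* x \in M_q; the element 0 is homogeneous of every degree. *)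
Definition homog {M} (q : int) (x : M) : Prop := hpart M q x = x.

Definition gsupp {M} (x : M) : seq int := xchoose (hpart_sum x).

(* The linear map acting on M_q as multiplication by (-1)^(k q): the Koszul sign
   for moving a map of degree k past an element (see [twist_homog]). *)
Definition twist {M} (k : int) (x : M) : M :=
  \sum_(q <- gsupp x) (-1 : K) ^ (k * q) *: hpart M q x.

Lemma twist_homog M (k q : int) (x : M) :
  homog q x -> twist k x = (-1 : K) ^ (k * q) *: x.
Proof.
rewrite /homog /twist /gsupp => hx.
have /andP[us /eqP xE] := xchooseP (hpart_sum x).
move: (xchoose _) us xE => s us xE.
have hp p : hpart M p x = if p == q then x else 0.
  by rewrite -[in LHS]hx hpart_orth hx.
have [qs|qs] := boolP (q \in s).
  rewrite (bigD1_seq q) //= hp eqxx big1 ?addr0 // => p /negPf pq.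
  by rewrite hp pq scaler0.
have x0 : x = 0.
  rewrite xE big_seq big1 // => p ps; rewrite hp ifN //.
  by apply: contraNneq qs => <-.
by rewrite x0 scaler0 big1 // => p _; rewrite linear0 scaler0.
Qed.

(* Linear maps from the n-th tensor power of M to N are represented by the
   corresponding multilinear functions of n arguments. *)
Definition tmap M N (n : nat) := n.-tuple M -> N.

Definition upd {M n} (x : n.-tuple M) (i : 'I_n) (u : M) : n.-tuple M :=
  [tuple if j == i then u else tnth x j | j < n].

Definition multilinear {M N n} (f : tmap M N n) : Prop :=
  forall (x : n.-tuple M) (i : 'I_n) (c : K) (u v : M),
    f (upd x i (c *: u + v)) = c *: f (upd x i u) + f (upd x i v).

Definition has_degree {M N n} (k : int) (f : tmap M N n) : Prop :=
  forall (d : 'I_n -> int) (x : n.-tuple M),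
    (forall i, homog (d i) (tnth x i)) -> homog (\sum_i d i + k) (f x).

(* f \in Hom^k(M^{\otimes n}, N) *)
Definition ghom {M N n} (k : int) (f : tmap M N n) : Prop :=
  multilinear f /\ has_degree k f.

(* f (x_1 (x) ... (x) x_n); the value 0 is only used on lists of wrong length. *)
Definition ev {M N n} (f : tmap M N n) (x : seq M) : N :=
  if insub x is Some t then f t else 0.

(* (1^r (x) g (x) 1^t) (x_1 (x) ... (x) x_{r+s+t}) for g of degree k:
   the degree k map g moves past x_1, ..., x_r. *)
Definition insert {M s} (r : nat) (k : int) (g : tmap M M s) (x : seq M) :
    seq M :=
  map (twist k) (take r x) ++ ev g (take s (drop r x)) :: drop (r + s) x.

(* (f_{k_1} (x) ... (x) f_{k_u}) (x_1 (x) ... (x) x_n), where f_i has degree e i: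
   f_{k_2} (x) ... (x) f_{k_u} moves past the first k_1 arguments, etc. *)
Fixpoint tensor {M N} (f : forall i, tmap M N i) (e : nat -> int)
    (ks : seq nat) (x : seq M) : seq N :=
  if ks is k :: ks' then
    ev (f k) (map (twist (\sum_(j <- ks') e j)) (take k x))
      :: tensor f e ks' (drop k x)
  else [::].

(* With indices counted from 0: s^-1 is increasing on [0, k) and on [k, n). *)
Definition is_shuffle (n k : nat) (s : 'S_n) : bool :=
  [forall i : 'I_n, forall j : 'I_n,
     ((i < j) && ((j < k) || (k <= i)))%N ==> (s^-1%g i < s^-1%g j)%N].

(* Koszul sign of a_1 (x) ... (x) a_n |-> a_{s 1} (x) ... (x) a_{s n}, with
   dim a_i = d i: each inversion of s contributes a transposition sign. *)
Definition koszul_sign (n : nat) (d : 'I_n -> int) (s : 'S_n) : K :=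
  \prod_(i < n) \prod_(j < n | ((i < j) && (s j < s i))%N)
    (-1) ^ (d (s i) * d (s j)).

(* f vanishes on Sh^n(M), i.e. on all its generators. *)
Definition vanish_Sh {M N n} (f : tmap M N n) : Prop :=
  forall (k : nat) (d : 'I_n -> int) (a : n.-tuple M),
    (1 <= k <= n.-1)%N -> (forall i, homog (d i) (tnth a i)) ->
    \sum_(s : 'S_n | is_shuffle k s)
      ((-1) ^+ s * koszul_sign d s) *: f [tuple tnth a (s i) | i < n] = 0.

Definition graded_comm_algebra {M} (mu : tmap M M 2) : Prop :=
  [/\ ghom 0 mu,
      forall a b c : M,
        mu [tuple mu [tuple a; b]; c] = mu [tuple a; mu [tuple b; c]]
    & forall (p q : int) (a b : M), homog p a -> homog q b ->
        mu [tuple a; b] = (-1 : K) ^ (p * q) *: mu [tuple b; a]].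

(* The Hochschild coboundary C^{n,k}(M,M) -> C^{n+1,k}(M,M); the sum runs over
   i = 1, ..., n with i shifted by one. *)
Definition hdelta {M} (mu : tmap M M 2) (n : nat) (k : int) (f : tmap M M n) :
    tmap M M n.+1 := fun x =>
  ev mu (insert 1 k f x)
  + \sum_(i < n) (-1) ^+ i.+1 *: ev f (insert i 0 mu x)
  + (-1) ^+ n.+1 *: ev mu (insert 0 k f x).

Definition harr_cochain {M} (n : nat) (k : int) (f : tmap M M n) : Prop :=
  ghom k f /\ vanish_Sh f.

Definition harr_cocycle {M} (mu : tmap M M 2) (n : nat) (k : int)
    (f : tmap M M n) : Prop :=
  harr_cochain k f /\ hdelta mu k f =1 (fun _ => 0).

Definition harr_coboundary {M} (mu : tmap M M 2) (n : nat) (k : int) :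
    tmap M M n -> Prop :=
  match n return tmap M M n -> Prop with
  | 0 => fun f => f =1 (fun _ => 0)
  | n'.+1 => fun f =>
      exists2 g : tmap M M n', harr_cochain k g & f =1 hdelta mu k g
  end.

(* Harr^{n,k}(M,M) = 0 *)
Definition harr_vanishes {M} (mu : tmap M M 2) (n : nat) (k : int) : Prop :=
  forall f : tmap M M n, harr_cocycle mu k f -> harr_coboundary mu k f.

(* Sequences of maps indexed by i >= 1; the entry of index 0 plays no role. *)
Definition tseq M N := forall i : nat, tmap M N i.

(* \sum_{r+s+t=n, s>=1} (-1)^(r+st) h_{r+1+t} (1^r (x) m_s (x) 1^t), where
   deg m_s = 2 - s. *)
Definition insert_sum {M N} (h : tseq M N) (m : tseq M M) (n : nat)
    (x : n.-tuple M) : N :=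
  \sum_(r < n.+1) \sum_(s < n.+1)
    \sum_(t < n.+1 | ((r + s + t == n) && (1 <= s))%N)
      (-1) ^+ (r + s * t) *: ev (h (r + 1 + t)%N) (insert r (2 - s%:Z) (m s) x).

Definition Ainfty {M} (m : tseq M M) : Prop :=
  (forall i, (1 <= i)%N -> ghom (2 - i%:Z) (m i)) /\
  (forall n (x : n.-tuple M), (1 <= n)%N -> insert_sum m m x = 0).

(* \sum_u \sum_{k_1+...+k_u=n} (-1)^(\sum_l (u-l)(k_l-1))
     m'_u (f_{k_1} (x) ... (x) f_{k_u}), where deg f_i = 1 - i; here l is
   counted from 0. *)
Definition tensor_sum {M N} (f : tseq M N) (m' : tseq N N) (n : nat)
    (x : n.-tuple M) : N :=
  \sum_(1 <= u < n.+1)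
    \sum_(ks : u.-tuple 'I_n.+1 |
          [forall l, (1 <= tnth ks l)%N] && (\sum_(l < u) tnth ks l == n)%N)
      (-1) ^+ (\sum_(l < u) (u - l.+1) * (tnth ks l - 1))%N *:
      ev (m' u) (tensor f (fun i => 1 - i%:Z) (map (@nat_of_ord _) ks) x).

Definition Ainfty_morphism {M N} (m : tseq M M) (m' : tseq N N)
    (f : tseq M N) : Prop :=
  (forall i, (1 <= i)%N -> ghom (1 - i%:Z) (f i)) /\
  (forall n (x : n.-tuple M), (1 <= n)%N ->
     insert_sum f m x = tensor_sum f m' x).

Definition comm_Ainfty {M} (m : tseq M M) : Prop :=
  Ainfty m /\ forall i, (1 <= i)%N -> vanish_Sh (m i).

Definition comm_Ainfty_morphism {M N} (m : tseq M M) (m' : tseq N N)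
    (f : tseq M N) : Prop :=
  Ainfty_morphism m m' f /\ forall i, (1 <= i)%N -> vanish_Sh (f i).

Definition comm_Ainfty_over {M} (mu : tmap M M 2) (m : tseq M M) : Prop :=
  [/\ comm_Ainfty m, m 1%N =1 (fun _ => 0) & m 2%N =1 mu].

Definition comm_Ainfty_equiv {M} (mu : tmap M M 2) (m m' : tseq M M) : Prop :=
  [/\ comm_Ainfty_over mu m, comm_Ainfty_over mu m'
    & exists p : tseq M M, comm_Ainfty_morphism m m' p /\
        forall x : M, p 1%N [tuple x] = x].

Definition trivial_Ainfty {M} (mu : tmap M M 2) : tseq M M := fun i =>
  match i return tmap M M i with
  | 2 => mu
  | _ => fun _ => 0
  end.

End GradedMaps.

(* Main.v *)
Require Import Defs.
From mathcomp Require Import all_boot all_order all_algebra all_fingroup zify.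
From Stdlib Require Import ClassicalEpsilon.

(** The required morphism is built one component at a time.

    Shift all degrees down by one. The operations m_i then become a function B
    on words in M, namely the corestriction of a coderivation d of the tensor
    coalgebra, and the A(infinity) relations say that B d = 0, whence d d = 0
    ([coder_coder]). Maps p_i of degree 1 - i likewise become a function P on
    words, and p is a morphism to the trivial structure exactly when P is a
    twisting cochain, that is when its curvature R = P d + P cup P vanishes
    ([insert_sum_coder], [tensor_sum_cup]). Three facts about R carry the proof.

    - The Bianchi identity R d + R cup P - P R = 0 ([bianchi]), a consequence
      of d d = 0 and of associativity. In the lowest arity in which R is nonzero
      it says that this component of R is a Hochschild cocycle
      ([obstruction_cocycle]).
    - If P vanishes on shuffles, then so does R ([curv_shuffle]). As B vanishes
      on shuffles, d is a derivation of the shuffle product ([sh_coder]), and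
      the coproduct is multiplicative for it ([sh_splits]); the two terms that
      remain in P cup P cancel because the product is graded commutative.
    - Adding g to p_n changes R in arity n + 1 by the Harrison coboundary of g,
      up to sign, and does not change it in lower arity ([flat_correction]).

    So the lowest component of R, in arity n + 1 with n at least 2, is a
    Harrison cocycle of degree 1 - n, hence the coboundary of some g
    ([obstruction_coboundary]), and adding g to p_n removes it. One starts from
    p = (id, 0, 0, ...), whose curvature vanishes up to arity two ([flat3]).
    Each p_n is corrected only once, so the corrections have a limit, and the
    curvature of the limit is zero ([limit_flat]).

    Tensor powers of M do not appear. The coproduct, the shuffle product and
    the coderivation are operators [splits], [sh] and [coder] on functions of
    words, which return the sum of the values of a function at the words that
    occur in the result. A letter of a word is an element with a label for its
    degree; signs are computed from the labels, and operations read off the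
    component in the labelled degree. The formal identities therefore hold for
    all words, and homogeneous elements matter only for the passage between
    functions of words and multilinear maps. *)

Set Implicit Arguments.
Unset Strict Implicit.
Unset Printing Implicit Defensive.

Import Order.TTheory GRing.Theory Num.Theory.
Local Open Scope ring_scope.

(** * Parities and Koszul signs *)

Definition par (z : int) : bool := odd `|z|%N.

Lemma parD y z : par (y + z) = par y (+) par z.
Proof.
have par2 (n : nat) : par n = odd n by [].
have parN (x : int) : par (- x) = par x by rewrite /par abszN.
have parB (a b : nat) : par (a%:Z - b%:Z) = odd a (+) odd b.
  have [ba|ab] := leqP b a; first by rewrite subzn // par2 oddB.
  by rewrite -parN opprB subzn 1?ltnW // par2 oddB 1?ltnW // addbC.
case: y => m; case: z => n; rewrite ?NegzE.
- by rewrite -PoszD par2 oddD.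
- by rewrite parB parN.
- by rewrite addrC parB parN addbC.
- by rewrite -opprD -PoszD !parN par2 oddD.
Qed.

Lemma parN z : par (- z) = par z. Proof. by rewrite /par abszN. Qed.

Lemma parM y z : par (y * z) = par y && par z.
Proof. by rewrite /par abszM oddM. Qed.

Lemma par_nat (n : nat) : par n = odd n. Proof. by []. Qed.

Lemma exprz_par (K : fieldType) (z : int) : (-1 : K) ^ z = (-1) ^+ par z.
Proof.
case: z => n; first by rewrite /par -exprnP signr_odd.
by rewrite NegzE parN par_nat signr_odd -exprnN -exprVn invrN1.
Qed.

(** * Words in the suspension *)

Section Words.
Context {K : fieldType} {M : gradedModule K}.

(** The integer is the degree in the suspension of [M], one less than the
    degree in [M]. It is a label: the element need not be homogeneous. *)
Definition letter : Type := (int * M)%type.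
Definition word : Type := seq letter.
Implicit Types (u v w x y t : word) (a b : letter) (V : lmodType K).

Definition sdeg w : int := foldr (fun a s => a.1 + s) 0 w.
Definition sg w : bool := par (sdeg w).

Lemma sdeg_cat u v : sdeg (u ++ v) = sdeg u + sdeg v.
Proof. by elim: u => [|a u /= ->]; rewrite ?add0r ?addrA. Qed.

Lemma sg_cat u v : sg (u ++ v) = sg u (+) sg v.
Proof. by rewrite /sg sdeg_cat parD. Qed.

Lemma sg_cons a w : sg (a :: w) = par a.1 (+) sg w.
Proof. exact: parD. Qed.

Definition is_lin V V' (f : V -> V') : Prop :=
  forall c z1 z2, f (c *: z1 + z2) = c *: f z1 + f z2.

Lemma is_lin0 V V' (f : V -> V') : is_lin f -> f 0 = 0.
Proof.
by move=> fl; have := fl (-1) 0 0; rewrite !scaler0 addr0 scaleN1r addNr.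
Qed.

Lemma is_linZ V V' (f : V -> V') c z : is_lin f -> f (c *: z) = c *: f z.
Proof. by move=> fl; have := fl c z 0; rewrite !addr0 (is_lin0 fl) addr0. Qed.

Lemma is_linD V V' (f : V -> V') z1 z2 : is_lin f -> f (z1 + z2) = f z1 + f z2.
Proof. by move=> fl; have := fl 1 z1 z2; rewrite !scale1r. Qed.

(** The deconcatenation coproduct of the tensor coalgebra, seen through a
    function [G] of the two factors. *)
Fixpoint splits V w (G : word -> word -> V) : V :=
  if w is a :: w' then G [::] w + splits w' (fun u v => G (a :: u) v)
  else G [::] [::].

Lemma eq_splits V w (G G' : word -> word -> V) :
  (forall u v, u ++ v = w -> G u v = G' u v) -> splits w G = splits w G'.
Proof.
elim: w G G' => [|a w IH] G G' eG /=; first by rewrite eG.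
by rewrite eG //; congr (_ + _); apply: IH => u v uv; rewrite eG //= uv.
Qed.

Lemma splits_lin V w c (G G' : word -> word -> V) :
  splits w (fun u v => c *: G u v + G' u v) = c *: splits w G + splits w G'.
Proof.
by elim: w G G' => [|a w IH] G G' //=; rewrite IH scalerDr addrACA.
Qed.

Lemma splitsD V w (G G' : word -> word -> V) :
  splits w (fun u v => G u v + G' u v) = splits w G + splits w G'.
Proof.
rewrite -[splits w G]scale1r -splits_lin.
by apply: eq_splits => u v _; rewrite scale1r.
Qed.

Lemma splits0 V w (G : word -> word -> V) :
  (forall u v, u ++ v = w -> G u v = 0) -> splits w G = 0.
Proof.
elim: w G => [|a w IH] G G0 /=; first exact: G0.
by rewrite G0 // IH ?addr0 // => u v uv; rewrite G0 //= uv.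
Qed.

Lemma splitsZ V w c (G : word -> word -> V) :
  splits w (fun u v => c *: G u v) = c *: splits w G.
Proof.
rewrite -[RHS]addr0 -[X in _ = _ + X](@splits0 V w (fun _ _ => 0)) //.
by rewrite -splits_lin; apply: eq_splits => u v _; rewrite addr0.
Qed.

Lemma splits_out V V' (f : V -> V') w (G : word -> word -> V) :
  is_lin f -> splits w (fun u v => f (G u v)) = f (splits w G).
Proof.
by move=> fl; elim: w G => [|a w IH] G //=; rewrite IH (is_linD _ _ fl).
Qed.

Lemma splitsN V w (G : word -> word -> V) :
  splits w (fun u v => - G u v) = - splits w G.
Proof.
by apply: (@splits_out _ _ (fun z => - z)) => c z1 z2; rewrite opprD scalerN.
Qed.

Lemma splits_sum V w (G : word -> word -> V) :
  splits w G = \sum_(i < (size w).+1) G (take i w) (drop i w).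
Proof.
elim: w G => [|a w IH] G /=; first by rewrite big_ord_recl big_ord0 addr0.
by rewrite big_ord_recl /= IH.
Qed.

Lemma splits_assoc V w (G : word -> word -> word -> V) :
  splits w (fun u z => splits z (fun v t => G u v t)) =
  splits w (fun z t => splits z (fun u v => G u v t)).
Proof.
elim: w G => [|a w IH] G //=.
by rewrite IH splitsD addrA.
Qed.

Lemma splits_right_nil V w (G : word -> word -> V) :
  (forall u b v, G u (b :: v) = 0) -> splits w G = G w [::].
Proof.
by elim: w G => [|a w IH] G G0 //=; rewrite G0 add0r IH.
Qed.

(** For summands with a factor that vanishes on proper shuffles: such a
    factor leaves only the cuts in which one of the two blocks is empty. *)
Lemma splits_axes V x y (G : word -> word -> word -> word -> V) :
  (forall a b x1 x2 y1 y2, G (a :: x1) x2 (b :: y1) y2 = 0) ->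
  G [::] x [::] y = 0 ->
  splits x (fun x1 x2 => splits y (fun y1 y2 => G x1 x2 y1 y2)) =
  splits x (fun x1 x2 => G x1 x2 [::] y) +
  splits y (fun y1 y2 => G [::] x y1 y2).
Proof.
move=> G0 G00.
have Gx a x1 x2 : splits y (fun y1 y2 => G (a :: x1) x2 y1 y2) =
    G (a :: x1) x2 [::] y.
  by case: y {G00} => [|b y] //=; rewrite splits0 ?addr0.
case: x G00 => [|a x] G00 /=.
  by rewrite G00 add0r.
rewrite addrC G00 add0r; congr (_ + _).
by apply: eq_splits => u v _; rewrite Gx.
Qed.

(** The signed shuffle product of [x] and [y], seen through a function of
    words. The sign is that of [b] moving past what is left of [x]. *)
Fixpoint sh V x : word -> (word -> V) -> V :=
  if x is a :: x' then
    fix sha y F {struct y} :=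
      if y is b :: y' then
        sh x' y (fun w => F (a :: w)) +
        (-1) ^+ (par b.1 && sg (a :: x')) *: sha y' (fun w => F (b :: w))
      else F x
  else fun y F => F y.

Lemma sh_cons V a x b y (F : word -> V) :
  sh (a :: x) (b :: y) F = sh x (b :: y) (fun w => F (a :: w)) +
    (-1) ^+ (par b.1 && sg (a :: x)) *: sh (a :: x) y (fun w => F (b :: w)).
Proof. by []. Qed.

Lemma sh0w V y (F : word -> V) : sh [::] y F = F y. Proof. by []. Qed.

Lemma shw0 V x (F : word -> V) : sh x [::] F = F x. Proof. by case: x. Qed.

End Words.

Arguments sh : simpl never.

Ltac parity_cases := try change (par 1) with true; repeat match goal with
  | |- context [par ?z] => case: (par z)
  | |- context [sg ?z] => case: (sg z)
  | |- context [odd ?z] => case: (odd z)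
  end; try by [].

(** * Shuffles and coderivations of the tensor coalgebra *)

Section Coalgebra.
Context {K : fieldType} {M : gradedModule K}.
Local Notation word := (@word K M).
Local Notation letter := (@letter K M).
Implicit Types (u v w x y t : word) (a b : letter) (V : lmodType K).

Lemma eq_sh V x y (F F' : word -> V) :
  (forall w, sdeg w = sdeg x + sdeg y -> size w = (size x + size y)%N ->
     F w = F' w) -> sh x y F = sh x y F'.
Proof.
elim: x y F F' => [|a x IHx] y F F' eF.
  by rewrite !sh0w; apply: eF; rewrite ?add0r.
elim: y F F' eF => [|b y IHy] F F' eF.
  by rewrite !shw0; apply: eF; rewrite ?addr0 ?addn0.
rewrite !sh_cons; congr (_ + _ *: _).
  by apply: IHx => w /= dw sw; apply: eF; rewrite /= ?dw ?sw ?addrA.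
by apply: IHy => w /= dw sw; apply: eF; rewrite /= ?dw ?sw ?addnS // addrCA.
Qed.

Lemma sh_lin V x y c (F F' : word -> V) :
  sh x y (fun w => c *: F w + F' w) = c *: sh x y F + sh x y F'.
Proof.
elim: x y F F' => [|a x IHx] y F F' //.
elim: y F F' => [|b y IHy] F F' //.
rewrite !sh_cons IHx IHy !scalerDr addrACA; congr (_ + (_ + _)).
by rewrite !scalerA mulrC.
Qed.

Lemma sh_out V V' (f : V -> V') x y (F : word -> V) :
  is_lin f -> sh x y (fun w => f (F w)) = f (sh x y F).
Proof.
move=> fl; elim: x y F => [|a x IHx] y F //.
elim: y F => [|b y IHy] F //.
by rewrite !sh_cons IHx IHy (is_linD _ _ fl) (is_linZ _ _ fl).
Qed.

Lemma shZ V x y c (F : word -> V) :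
  sh x y (fun w => c *: F w) = c *: sh x y F.
Proof.
apply: (@sh_out _ _ (fun z => c *: z)) => k u v.
by rewrite scalerDr !scalerA mulrC.
Qed.

Lemma shD V x y (F F' : word -> V) :
  sh x y (fun w => F w + F' w) = sh x y F + sh x y F'.
Proof.
rewrite -[sh x y F]scale1r -sh_lin.
by apply: eq_sh => w _ _; rewrite scale1r.
Qed.

(** The tensor coalgebra with the shuffle product is a bialgebra: cutting a
    shuffle of [x] and [y] amounts to cutting both words and shuffling the
    left parts and the right parts, [y1] moving past [x2]. *)
Lemma sh_splits V x y (G : word -> word -> V) :
  sh x y (fun w => splits w G) =
  splits x (fun x1 x2 => splits y (fun y1 y2 =>
    (-1) ^+ (sg x2 && sg y1) *: sh x1 y1 (fun u => sh x2 y2 (G u)))).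
Proof.
elim: x y G => [|a x IHx] y G.
  by rewrite /=; apply: eq_splits => u v _; rewrite scale1r.
elim: y G => [|b y IHy] G.
  rewrite shw0 [splits (a :: x) G]/= [RHS]/= andbF scale1r; congr (_ + _).
  by apply: eq_splits => u v _; rewrite andbF scale1r !shw0.
rewrite sh_cons.
have step c w z : sh w z (fun v => splits (c :: v) G) =
    sh w z (fun v => G [::] (c :: v)) +
    sh w z (fun v => splits v (fun v1 v2 => G (c :: v1) v2)).
  by rewrite -shD.
rewrite !step IHx IHy scalerDr addrACA.
pose Ph x1 x2 y1 y2 :=
  (-1) ^+ (sg x2 && sg y1) *: sh x1 y1 (fun u => sh x2 y2 (G u)).
transitivity (splits (a :: x) (fun x1 x2 => splits (b :: y) (Ph x1 x2)));
  last by [].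
(* the cuts are sorted by whether [x1] and [y1] are empty *)
rewrite -[RHS]/(Ph [::] (a :: x) [::] (b :: y) +
  splits y (fun y1 y2 => Ph [::] (a :: x) (b :: y1) y2) +
  splits x (fun x1 x2 => Ph (a :: x1) x2 [::] (b :: y) +
    splits y (fun y1 y2 => Ph (a :: x1) x2 (b :: y1) y2))).
rewrite -[RHS]addrA; congr (_ + _).
  by rewrite /Ph /= andbF scale1r.
rewrite addrC /= scalerDr -addrA; congr (_ + _).
  rewrite -splitsZ; apply: eq_splits => y1 y2 _.
  rewrite scalerA -signr_addb /Ph /=; congr (_ ^+ _ *: _).
  by rewrite !(sg_cons b); parity_cases.
rewrite -splitsZ -splitsD; apply: eq_splits => x1 x2 x12.
rewrite addrCA; congr (_ + _).
  by rewrite /Ph !shw0.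
rewrite -splitsZ -splitsD; apply: eq_splits => y1 y2 _.
rewrite addrC /Ph sh_cons scalerDr !scalerA -!signr_addb.
congr (_ + _ ^+ _ *: _).
by rewrite -x12 !sg_cons sg_cat; parity_cases.
Qed.

Definition word_multilin V (F : word -> V) : Prop :=
  forall u e t, is_lin (fun z => F (u ++ (e, z) :: t)).

Lemma word_multilin_cons V a (F : word -> V) : word_multilin F ->
  word_multilin (fun w => F (a :: w)).
Proof. by move=> lF u; apply: lF (a :: u). Qed.

Lemma word_multilin_head V (F : word -> V) e t : word_multilin F ->
  is_lin (fun z => F ((e, z) :: t)).
Proof. by move=> lF; apply: lF [::] e t. Qed.

Lemma word_multilin_splits V (G : word -> word -> V) :
  (forall v, word_multilin (fun u => G u v)) ->
  (forall u, word_multilin (G u)) ->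
  word_multilin (fun w => splits w G).
Proof.
move=> G1 G2 u e t c z1 z2.
elim: u G G1 G2 => [|a u IH] G G1 G2 /=.
  rewrite word_multilin_head // scalerDr addrACA -splits_lin; congr (_ + _).
  by apply: eq_splits => x y _; apply: (word_multilin_head e x (G1 y)).
rewrite [G [::] _](G2 [::] (a :: u)) scalerDr addrACA; congr (_ + _).
by apply: IH => // v; apply: (word_multilin_cons a (G1 v)).
Qed.

Section Coderivation.
Variable B : word -> M.

(** The label is the degree of the value when [B] has degree one. *)
Definition opletter v : letter := (sdeg v + 1, B v).

(** The coderivation of the tensor coalgebra with corestriction [B], seen
    through a function of words: each nonempty block of letters is replaced by
    its value. The first summand collects the blocks at the head of the word;
    the others lie behind the first letter, which [B] has to move past. *)
Fixpoint coder V w (F : word -> V) : V :=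
  if w is a :: w' then
    splits w' (fun v t => F (opletter (a :: v) :: t)) +
    (-1) ^+ par a.1 *: coder w' (fun u => F (a :: u))
  else 0.

Lemma eq_coder V w (F F' : word -> V) :
  (forall z, sdeg z = sdeg w + 1 -> (0 < size z <= size w)%N -> F z = F' z) ->
  coder w F = coder w F'.
Proof.
elim: w F F' => [|a w IH] F F' eF //=.
congr (_ + _ *: _).
  apply: eq_splits => u v uv; apply: eF => /=.
    by rewrite -uv sdeg_cat addrAC !addrA.
  by rewrite -uv size_cat ltnS leq_addl.
apply: IH => z dz /andP[_ sz]; apply: eF => //=.
by rewrite dz addrA.
Qed.

Lemma coder_lin V w c (F F' : word -> V) :
  coder w (fun z => c *: F z + F' z) = c *: coder w F + coder w F'.
Proof.
elim: w F F' => [|a w IH] F F' /=; first by rewrite scaler0 addr0.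
by rewrite splits_lin IH !scalerDr addrACA !scalerA mulrC.
Qed.

Lemma coderD V w (F F' : word -> V) :
  coder w (fun z => F z + F' z) = coder w F + coder w F'.
Proof.
rewrite -[coder w F]scale1r -coder_lin.
by apply: eq_coder => z _ _; rewrite scale1r.
Qed.

Lemma coder_out V V' (f : V -> V') w (F : word -> V) :
  is_lin f -> coder w (fun z => f (F z)) = f (coder w F).
Proof.
move=> fl; elim: w F => [|a w IH] F /=; first by rewrite (is_lin0 fl).
by rewrite IH (is_linD _ _ fl) (is_linZ _ _ fl) (splits_out _ _ fl).
Qed.

Lemma is_linZl V (c : K) : is_lin (fun z : V => c *: z).
Proof. by move=> k u v; rewrite scalerDr !scalerA mulrC. Qed.

Lemma coderZ V w c (F : word -> V) :
  coder w (fun z => c *: F z) = c *: coder w F.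
Proof. exact: (@coder_out _ _ (fun z => c *: z) _ _ (is_linZl c)). Qed.

Lemma coder0 V w (F : word -> V) :
  (forall z, (0 < size z)%N -> F z = 0) -> coder w F = 0.
Proof.
move=> F0; rewrite (eq_coder (F' := fun _ => 0 *: 0)) ?coderZ ?scale0r //.
by move=> z _ /andP[/F0 -> _].
Qed.

(** The rule that makes it a coderivation: in every cut of the new word, the
    letter that replaced a block lies on one of the two sides. *)
Lemma coder_splits V w (G : word -> word -> V) :
  coder w (fun z => splits z G) =
  splits w (fun u v =>
    coder u (fun z => G z v) + (-1) ^+ sg u *: coder v (G u)).
Proof.
elim: w G => [|a w IH] G /=; first by rewrite scaler0 addr0.
rewrite coderD IH scale1r add0r scalerDr splitsD.
rewrite addrACA; congr (_ + _).
rewrite splits_assoc -splitsZ -splitsD; apply: eq_splits => u v _.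
by rewrite scalerDr addrA scalerA -signr_addb -sg_cons.
Qed.

Hypothesis Bm : word_multilin B.

Lemma opletter_lin V (F : word -> V) u t u' e v' : word_multilin F ->
  is_lin (fun z => F (u ++ opletter (u' ++ (e, z) :: v') :: t)).
Proof. by move=> Fm c z1 z2; rewrite /opletter Bm !sdeg_cat /= Fm. Qed.

Lemma word_multilin_coder V (F : word -> V) : word_multilin F ->
  word_multilin (fun w => coder w F).
Proof.
move=> Fm u e t c z1 z2; elim: u F Fm => [|a u IH] F Fm /=.
  rewrite scalerDr addrACA; congr (_ + _).
    rewrite -splits_lin; apply: eq_splits => v z _.
    exact: (@opletter_lin _ F [::] z [::] e v).
  rewrite scalerA mulrC -scalerA -scalerDr -coder_lin; congr (_ *: _).
  by apply: eq_coder => z _ _; apply: word_multilin_head.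
rewrite IH; last exact: word_multilin_cons.
rewrite (@word_multilin_splits _ (fun v t => F (opletter (a :: v) :: t))) //.
- by rewrite !scalerDr addrACA !scalerA mulrC.
- by move=> v u' e' t' c' z1' z2'; apply: (@opletter_lin _ F [::] v (a :: u')).
- by move=> v u' e' t' c' z1' z2'; apply: (Fm (opletter (a :: v) :: u')).
Qed.

Hypothesis BB : forall w, coder w B = 0.

(** The coderivation squares to zero. Two disjoint blocks are evaluated in both
    orders with opposite signs. When one block contains the other, the sum over
    the inner block produces the letter with element [coder _ B], which is
    zero. *)
Lemma coder_coder V w (F : word -> V) : word_multilin F ->
  coder w (fun z => coder z F) = 0.
Proof.
elim: w F => [|a w IH] F Fm //=.
rewrite splitsD coderD coderZ IH ?scaler0 ?addr0;
  last exact: word_multilin_cons.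
rewrite coder_splits splits_assoc -splitsZ -!splitsD.
apply: splits0 => u v _ /=.
rewrite scalerDr addrACA scalerA -signr_addb -scalerDl.
(* disjoint blocks: the block evaluated first has become a letter of degree one
   more when the other one moves past it *)
have -> : (-1) ^+ par (a.1 + sdeg u + 1) + (-1) ^+ (par a.1 (+) sg u) = 0 :> K.
  by rewrite !parD -/(sg u) addbT signrN addNr.
rewrite scale0r addr0.
have := BB (a :: u) => /= BBu.
pose f z := F ((sdeg (a :: u) + 1 + 1, z) :: v).
have fl : is_lin f by apply: word_multilin_head.
rewrite -(is_lin0 fl) -BBu (is_linD _ _ fl) (is_linZ _ _ fl) -(coder_out _ _ fl)
  -(splits_out _ _ fl).
congr (_ + _ *: _).
  apply: eq_splits => u1 u2 u12; rewrite /f /opletter /= -u12.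
  by rewrite sdeg_cat !addrA (addrAC _ 1).
apply: eq_coder => z dz _; rewrite /f /opletter /=.
by rewrite dz !addrA.
Qed.

Hypothesis B0 : B [::] = 0.

(** When [B] vanishes on the empty word, the empty block may be added at the
    head, so that the head blocks form a full sum over cuts. *)
Lemma coderE V w (F : word -> V) : word_multilin F ->
  coder w F = splits w (fun v t => F (opletter v :: t)) +
    (if w is a :: w' then (-1) ^+ par a.1 *: coder w' (fun u => F (a :: u))
     else 0).
Proof.
move=> Fm; have F0 e t : F ((e, 0) :: t) = 0.
  by rewrite (is_lin0 (word_multilin_head e t Fm)).
by case: w => [|a w] /=; rewrite /opletter B0 !F0 ?add0r ?addr0.
Qed.

Hypothesis Bsh : forall x y, (0 < size x)%N -> (0 < size y)%N -> sh x y B = 0.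

Lemma coder_shl V a x b y (F : word -> V) :
  coder (a :: x) (fun w => sh w (b :: y) F) =
  splits x (fun v t => sh t (b :: y) (fun w => F (opletter (a :: v) :: w))) +
  (-1) ^+ par a.1 *: coder x (fun w => sh w (b :: y) (fun u => F (a :: u))) +
  (-1) ^+ (par b.1 && ~~ sg (a :: x)) *:
    coder (a :: x) (fun w => sh w y (fun u => F (b :: u))).
Proof.
rewrite /= scalerDr -splitsZ addrACA -splitsD; congr (_ + _).
  apply: eq_splits => u v uv; rewrite sh_cons; congr (_ + _ ^+ _ *: _).
  by rewrite -uv !sg_cons /opletter /= sg_cat !parD -/(sg u); parity_cases.
rewrite scalerA mulrC -scalerA -scalerDr; congr (_ *: _);
  rewrite -coderZ -coderD.
apply: eq_coder => w dw _; rewrite sh_cons; congr (_ + _ ^+ _ *: _).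
by rewrite !sg_cons /sg dw !parD; parity_cases.
Qed.

Lemma coder_shr V a x b y (F : word -> V) :
  coder (b :: y) (fun w => sh (a :: x) w F) =
  coder (b :: y) (fun w => sh x w (fun u => F (a :: u))) +
  splits y (fun v t => (-1) ^+ (par (opletter (b :: v)).1 && sg (a :: x)) *:
    sh (a :: x) t (fun w => F (opletter (b :: v) :: w))) +
  (-1) ^+ par b.1 *: ((-1) ^+ (par b.1 && sg (a :: x)) *:
    coder y (fun w => sh (a :: x) w (fun u => F (b :: u)))).
Proof.
rewrite /= -[RHS]addrA addrACA -splitsD -scalerDr; congr (_ + _ *: _).
by rewrite -coderZ -coderD; apply: eq_coder => w _ _; rewrite sh_cons.
Qed.

(** The coderivation is a derivation of the shuffle product. In a shuffle of
    [x] and [y], cut off the head block: by the bialgebra property it is itself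
    a shuffle of a piece of [x] and a piece of [y], so it contributes zero
    unless one of the pieces is empty. The remaining blocks are handled by
    induction on the two words. *)
Lemma sh_coder V x y (F : word -> V) : word_multilin F ->
  sh x y (fun w => coder w F) =
  coder x (fun w => sh w y F) + (-1) ^+ sg x *: coder y (fun w => sh x w F).
Proof.
elim: x y F => [|a x IHx] y F Fm.
  by rewrite sh0w /= add0r scale1r.
elim: y F Fm => [|b y IHy] F Fm.
  rewrite shw0 [coder [::] _]/= scaler0 addr0.
  by apply: eq_coder => w _ _; rewrite shw0.
pose D w : V :=
  if w is c :: w' then (-1) ^+ par c.1 *: coder w' (fun u => F (c :: u)) else 0.
rewrite (eq_sh (F' := fun w => splits w (fun v t => F (opletter v :: t)) +
  D w));
  last by move=> w _ _; apply: coderE.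
rewrite shD sh_splits.
(* [Ph] is the part in which the head block is a shuffle of [x1] and [y1]; in
   [SX] and [SY] it lies in one of the two words *)
pose H e z x2 y2 := sh x2 y2 (fun t => F ((e, z) :: t)).
have Hl e x2 y2 : is_lin (fun z => H e z x2 y2).
  move=> c z1 z2; rewrite /H -sh_lin; apply: eq_sh => w _ _.
  exact: word_multilin_head.
pose Ph x1 x2 y1 y2 :=
  (-1) ^+ (sg x2 && sg y1) *: H (sdeg x1 + sdeg y1 + 1) (sh x1 y1 B) x2 y2.
rewrite (eq_splits (G' := fun x1 x2 => splits (b :: y) (Ph x1 x2))); last first.
  move=> x1 x2 _; apply: eq_splits => y1 y2 _; congr (_ *: _).
  rewrite -(sh_out _ _ _ (Hl _ x2 y2)); apply: eq_sh => w dw _.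
  by rewrite /H /opletter dw.
rewrite splits_axes; last first.
- by rewrite /Ph sh0w B0 (is_lin0 (Hl _ _ _)) scaler0.
- by move=> c d x1 x2 y1 y2; rewrite /Ph Bsh // (is_lin0 (Hl _ _ _)) scaler0.
rewrite sh_cons {}/D shZ shZ IHx ?IHy; try exact: word_multilin_cons.
have SX : splits (a :: x) (fun x1 x2 => Ph x1 x2 [::] (b :: y)) =
    splits x (fun v t => sh t (b :: y) (fun w => F (opletter (a :: v) :: w))).
  rewrite /= {1}/Ph sh0w B0 (is_lin0 (Hl _ _ _)) scaler0 add0r.
  by apply: eq_splits => u v _; rewrite /Ph andbF scale1r shw0 /H addr0.
have SY : splits (b :: y) (fun y1 y2 => Ph [::] (a :: x) y1 y2) =
    (-1) ^+ sg (a :: x) *: splits y (fun v t =>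
      (-1) ^+ (par (opletter (b :: v)).1 && sg (a :: x)) *:
      sh (a :: x) t (fun w => F (opletter (b :: v) :: w))).
  rewrite /= {1}/Ph sh0w B0 (is_lin0 (Hl _ _ _)) scaler0 add0r -splitsZ.
  apply: eq_splits => u v _; rewrite /Ph sh0w /H add0r scalerA -signr_addb.
  by congr (_ ^+ _ *: _); rewrite /opletter /sg /= !parD; parity_cases.
rewrite coder_shl coder_shr SX SY.
move: (coder (a :: x) _) (coder (b :: y) _) => U3 U2.
rewrite !scalerDr !scalerA -!signr_addb -!addrA.
congr (_ + _); rewrite addrCA; congr (_ + _); rewrite addrCA [RHS]addrCA.
congr (_ ^+ _ *: _ + _); first by rewrite sg_cons.
rewrite addrCA; congr (_ ^+ _ *: _ + _); first by rewrite sg_cons; parity_cases.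
by congr (_ + _ ^+ _ *: _); parity_cases.
Qed.

End Coderivation.
End Coalgebra.

(** * The curvature of a cochain *)

Section Curvature.
Context {K : fieldType} {M : gradedModule K}.
Local Notation word := (@word K M).
Local Notation letter := (@letter K M).
Implicit Types (u v w x y t : word) (a b : letter).
Variable mul : M -> M -> M.
Hypothesis mulA : forall z1 z2 z3, mul (mul z1 z2) z3 = mul z1 (mul z2 z3).
Hypothesis mull : forall z, is_lin (fun z1 => mul z1 z).
Hypothesis mulr : forall z, is_lin (mul z).

Lemma bil0l z : mul 0 z = 0. Proof. exact: is_lin0 (mull z). Qed.
Lemma bil0r z : mul z 0 = 0. Proof. exact: is_lin0 (mulr z). Qed.

(** The convolution product on functions from the tensor coalgebra to the
    algebra; [g], of odd degree in the intended use, moves past [u]. *)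
Definition cup (f g : word -> M) w : M :=
  splits w (fun u v => (-1) ^+ sg u *: mul (f u) (g v)).

Lemma word_multilin_cup (f g : word -> M) : word_multilin f ->
  word_multilin g -> word_multilin (fun w => cup f g w).
Proof.
move=> fm gm; apply: word_multilin_splits.
  move=> v u e t c z1 z2; rewrite /= fm mull !sg_cat !sg_cons.
  by rewrite scalerDr !scalerA mulrC.
by move=> u v e t c z1 z2; rewrite /= gm mulr scalerDr !scalerA mulrC.
Qed.

Lemma cup_assoc (f g h : word -> M) w :
  cup (cup f g) h w = splits w (fun u v => mul (f u) (cup g h v)).
Proof.
rewrite /cup.
rewrite [RHS](eq_splits (G' := fun u z => splits z (fun v t =>
  (-1) ^+ sg v *: mul (f u) (mul (g v) (h t))))); last first.
  move=> u z _; rewrite -(splits_out _ _ (mulr (f u))).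
  by apply: eq_splits => v t _; rewrite (is_linZ _ _ (mulr (f u))).
rewrite splits_assoc; apply: eq_splits => z t _.
rewrite -(splits_out _ _ (mull (h t))) -splitsZ; apply: eq_splits => u v <-.
rewrite (is_linZ _ _ (mull (h t))) mulA scalerA -signr_addb sg_cat.
by congr (_ ^+ _ *: _); parity_cases.
Qed.

Variables B P : word -> M.
Hypothesis Bm : word_multilin B.
Hypothesis BB : forall w, coder B w B = 0.
Hypothesis Pm : word_multilin P.

(** The Maurer-Cartan expression of [P]: it vanishes exactly when [P] is a
    twisting cochain, which is to say a morphism to the algebra [mul]. *)
Definition curv w : M := coder B w P + cup P P w.

Lemma word_multilin_curv : word_multilin curv.
Proof.
move=> u e t c z1 z2; rewrite /curv (word_multilin_coder Bm Pm)
  (word_multilin_cup Pm Pm).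
by rewrite scalerDr addrACA.
Qed.

(** The Bianchi identity. As the coderivation squares to zero, applying it to
    the curvature leaves the derivative of [cup P P]. There [coder _ P] equals
    the curvature minus [cup P P], and the two cubic terms in [P] agree by
    associativity. *)
Lemma bianchi w :
  coder B w curv + cup curv P w - splits w (fun u v => mul (P u) (curv v)) = 0.
Proof.
have cupD (f g h : word -> M) z :
    cup (fun w => f w + g w) h z = cup f h z + cup g h z.
  rewrite /cup -splitsD; apply: eq_splits => u v _.
  by rewrite (is_linD _ _ (mull _)) scalerDr.
have d_cup : coder B w (cup P P) =
    splits w (fun u v => mul (P u) (coder B v P)) -
    cup (fun u => coder B u P) P w.
  rewrite /cup coder_splits -splitsN -splitsD; apply: eq_splits => u v _.
  rewrite coderZ scalerA -signr_addb addbb scale1r (coder_out _ _ _ (mulr _)).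
  rewrite addrC; congr (_ + _).
  rewrite (eq_coder _ (F' := fun z => - (-1) ^+ sg u *: mul (P z) (P v))).
    by rewrite coderZ (coder_out _ _ _ (mull _)) scaleNr.
  (* [coder] raises the degree by one, whence the sign *)
  by move=> z dz _; rewrite {1}/sg dz parD addbT signrN.
have := coder_coder BB w Pm; rewrite /curv => dd.
rewrite coderD dd add0r d_cup cupD cup_assoc.
rewrite [X in _ - X](eq_splits (G' := fun u v =>
  mul (P u) (coder B v P) + mul (P u) (cup P P v))); last first.
  by move=> u v _; rewrite (is_linD _ _ (mulr _)).
by rewrite splitsD addrA subrK subrr.
Qed.

(** The curvature vanishes on shuffles when [B] and [P] do. The linear term
    does because the coderivation is a derivation of the shuffle product; in
    the quadratic term only the two cuts separating [x] from [y] survive, and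
    their contributions cancel by graded commutativity. *)
Lemma curv_shuffle x y :
  B [::] = 0 -> P [::] = 0 ->
  (forall x y, (0 < size x)%N -> (0 < size y)%N -> sh x y B = 0) ->
  (forall x y, (0 < size x)%N -> (0 < size y)%N -> sh x y P = 0) ->
  (forall u v, mul (P u) (P v) =
     (-1) ^+ (~~ sg u && ~~ sg v) *: mul (P v) (P u)) ->
  (0 < size x)%N -> (0 < size y)%N -> sh x y curv = 0.
Proof.
move=> B0 P0 Bsh Psh PC x0 y0; rewrite /curv shD sh_coder //.
rewrite !coder0 ?scaler0 ?add0r; try by move=> z z0; rewrite Psh.
rewrite /cup sh_splits.
pose Ph x1 x2 y1 y2 := (-1) ^+ (sg x2 && sg y1) *: ((-1) ^+ (sg x1 (+) sg y1) *:
  mul (sh x1 y1 P) (sh x2 y2 P)).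
rewrite (eq_splits (G' := fun x1 x2 => splits y (Ph x1 x2))); last first.
  move=> x1 x2 _; apply: eq_splits => y1 y2 _; congr (_ *: _).
  rewrite -(sh_out _ _ _ (mull _)) -shZ; apply: eq_sh => w dw _.
  by rewrite {1}/sg dw parD -!/(sg _) shZ (sh_out _ _ _ (mulr _)).
rewrite splits_axes.
- rewrite !splits_right_nil.
  + rewrite /Ph !shw0 !sh0w PC !scalerA -!signr_addb addrC.
    rewrite -scalerDl /sg /= -!/(sg _).
    by case: (sg x); case: (sg y);
      rewrite /= ?expr0 ?expr1 ?addNr ?subrr scale0r.
  + by move=> u b v; rewrite /Ph (Psh x) // bil0r !scaler0.
  + by move=> u b v; rewrite /Ph (Psh (b :: v)) // bil0r !scaler0.
- by move=> a b x1 x2 y1 y2; rewrite /Ph Psh // bil0l !scaler0.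
- by rewrite /Ph sh0w P0 bil0l !scaler0.
Qed.
End Curvature.

(** * The part of lowest arity *)

Section Arity.
Context {K : fieldType} {M : gradedModule K}.
Local Notation word := (@word K M).
Local Notation letter := (@letter K M).
Implicit Types (u v w x y t : word) (a b : letter) (V : lmodType K).
Variable B : word -> M.
Hypothesis B1 : forall a, B [:: a] = 0.

(** The part of the coderivation that comes from the binary operation, which
    is the inner part of the Hochschild coboundary. *)
Fixpoint contract V w (F : word -> V) : V :=
  if w is a :: w' then
    (if w' is b :: t then F (opletter B [:: a; b] :: t) else 0) +
    (-1) ^+ par a.1 *: contract w' (fun u => F (a :: u))
  else 0.

(** For a function supported on words at most one letter shorter, blocks of
    three letters or more yield words that are too short. *)
Lemma coder_contract V w (F : word -> V) : word_multilin F ->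
  (forall z, (size z < (size w).-1)%N -> F z = 0) -> coder B w F = contract w F.
Proof.
elim: w F => [|a w IH] F Fm F0 //=; congr (_ + _ *: _).
  case: w F0 {IH} => [|b w] F0 /=.
    by rewrite /opletter B1 (is_lin0 (word_multilin_head _ _ Fm)).
  rewrite {1}/opletter B1 (is_lin0 (word_multilin_head _ _ Fm)) add0r.
  case: w F0 => [|c w] F0 //=.
  rewrite splits0 ?addr0 // => u v uv; apply: F0 => /=.
  by rewrite -uv !size_cat /= !ltnS leq_addl.
apply: IH => [|z]; first exact: word_multilin_cons.
by case: w F0 => [|b w] // F0 sz; apply: F0; rewrite /= ltnS.
Qed.

Lemma contract_cons V a b w (F : word -> V) :
  contract (a :: b :: w) F = F (opletter B [:: a; b] :: w) +
    (-1) ^+ par a.1 *: contract (b :: w) (fun u => F (a :: u)).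
Proof. by []. Qed.

Lemma contract_sum V w (F : word -> V) :
  contract w F = \sum_(i < (size w).-1) (-1) ^+ sg (take i w) *:
    F (take i w ++ opletter B (take 2 (drop i w)) :: drop i.+2 w).
Proof.
elim: w F => [|a w IH] F /=; first by rewrite big_ord0.
case: w IH => [|b w] IH; first by rewrite big_ord0 /= scaler0 addr0.
rewrite IH big_ord_recl /= take0 drop0 scale1r; congr (_ + _).
rewrite scaler_sumr; apply: eq_bigr => i _.
by rewrite scalerA -signr_addb -sg_cons.
Qed.

Lemma contract_eq0 V w (F : word -> V) :
  (forall z, size z = (size w).-1 -> F z = 0) -> contract w F = 0.
Proof.
elim: w F => [|a w IH] F F0 //.
case: w IH F0 => [|b w] IH F0; first by rewrite /= scaler0 addr0.
rewrite contract_cons F0 // IH ?scaler0 ?addr0 // => z /= sz.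
by rewrite F0 //= sz.
Qed.
End Arity.

(** * Shuffle permutations *)

Section ShufflePerm.
Context {K : fieldType} {M : gradedModule K}.
Local Notation word := (@word K M).
Local Notation letter := (@letter K M).
Implicit Types (u v w x y t : word) (a b : letter) (V : lmodType K).

Lemma lift_perm0_bij n :
  bijective (fun p : 'I_n.+1 * 'S_n => lift_perm ord0 p.1 p.2).
Proof.
apply: inj_card_bij; last by rewrite card_prod card_ord !card_Sn factS.
case=> j s [j' s'] /= /permP e.
have := e ord0; rewrite !lift_perm_id => ej; subst j'; congr (_, _).
by apply/permP => i; have := e (lift ord0 i); rewrite !lift_perm_lift =>
  /lift_inj.
Qed.

Lemma sum_perm_lift V n (Q : pred 'S_n.+1) (G : 'S_n.+1 -> V) :
  \sum_(s | Q s) G s =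
  \sum_(j < n.+1) \sum_(s : 'S_n | Q (lift_perm ord0 j s))
    G (lift_perm ord0 j s).
Proof.
rewrite (reindex _ (onW_bij _ (@lift_perm0_bij n))) /=.
by rewrite pair_big_dep.
Qed.

Lemma shuffleP n k (s : 'S_n) : reflect
  (forall i j : 'I_n, (i < j)%N -> (j < k)%N || (k <= i)%N ->
     ((s^-1)%g i < (s^-1)%g j)%N) (is_shuffle k s).
Proof.
apply: (iffP forallP) => [H i j ij jk|H i].
  by have /forallP/(_ j) := H i; rewrite ij jk.
by apply/forallP => j; apply/implyP => /andP[]; apply: H.
Qed.

(** In a shuffle of two increasing blocks, the first place is taken by the
    first element of one of the blocks. *)
Lemma shuffle_lift n k (j : 'I_n.+1) (s : 'S_n) :
  is_shuffle k (lift_perm ord0 j s) =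
  ((j == 0 :> nat) && (0 < k)%N && is_shuffle k.-1 s)
  || ((j == k :> nat) && is_shuffle k s).
Proof.
have inv i : ((lift_perm ord0 j s)^-1)%g (lift j i) = lift ord0 ((s^-1)%g i).
  by rewrite lift_permV lift_perm_lift.
have invj : ((lift_perm ord0 j s)^-1)%g j = ord0.
  by rewrite lift_permV lift_perm_id.
have liftE (i : 'I_n) : lift j i = (if (j <= i)%N then i.+1 else i) :> nat.
  by rewrite /= /bump; case: leqP.
apply/shuffleP/idP => [H|H].
  have jE : (j == 0 :> nat) && (0 < k)%N || (j == k :> nat).
    apply: contraT => jN.
    (* a smaller element of the block of [j] would have to precede [j] *)
    have [jk|kj] := ltnP j k.
      have j0 : (0 < j)%N by lia.
      by have := H ord0 j j0; rewrite jk invj ltn0 => /(_ isT).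
    have kj' : (k < j)%N by lia.
    have := H (Ordinal (ltn_trans kj' (ltn_ord j))) j kj'.
    by rewrite leqnn orbT invj ltn0 => /(_ isT).
  have HS k' : (forall i1 i2 : 'I_n,
      (i1 < i2)%N -> (i2 < k')%N || (k' <= i1)%N ->
      (lift j i1 < lift j i2)%N && ((lift j i2 < k)%N || (k <= lift j i1)%N)) ->
      is_shuffle k' s.
    move=> bl; apply/shuffleP => i1 i2 i12 i12k.
    have /andP[l12 l12k] := bl _ _ i12 i12k.
    by have := H _ _ l12 l12k; rewrite !inv.
  have [/andP[/eqP j0 k0]|jk] := boolP ((j == 0 :> nat) && (0 < k)%N).
    rewrite HS // => i1 i2; rewrite !liftE; clear H HS; do 2 case: ifP; lia.
  rewrite (negPf jk) /= in jE *; rewrite jE /=.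
  apply: HS => i1 i2; rewrite !liftE; clear H; do 2 case: ifP; lia.
move=> i1 i2; case: (unliftP j i1) => [i1'|] ->; last first.
  rewrite invj; case: (unliftP j i2) => [i2'|] ->; last by rewrite ltnn.
  by rewrite inv.
case: (unliftP j i2) => [i2'|] ->; last first.
  by rewrite liftE; case/orP: H => /andP[H _]; case: ifP; lia.
rewrite !inv !liftE /= /bump !leq0n !add1n ltnS.
case/orP: H => /andP[jk /shuffleP H] l12 bl; apply: H;
  by move: l12 bl; do 2 case: ifP; lia.
Qed.

Lemma koszul_lift n (d : 'I_n.+1 -> int) (j : 'I_n.+1) (s : 'S_n) :
  koszul_sign d (lift_perm ord0 j s) =
  (\prod_(i < n.+1 | (i < j)%N) (-1) ^ (d j * d i)) *
  koszul_sign (fun i => d (lift j i)) s :> K.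
Proof.
rewrite /koszul_sign big_ord_recl lift_perm_id; congr (_ * _).
  rewrite [RHS](reindex_inj (@perm_inj _ (lift_perm ord0 j s))).
  apply: eq_bigl => i; case: (unliftP ord0 i) => [i'|] -> //.
  by rewrite lift_perm_id !ltnn.
apply: eq_bigr => i _; rewrite big_mkcond big_ord_recl /= mul1r -big_mkcond.
apply: eq_big => [i'|i' _]; rewrite ?lift_perm_lift //=.
rewrite /bump !leq0n !add1n ltnS; congr (_ && _).
by case: leqP; case: leqP => h1 h2; rewrite ?add0n ?add1n; lia.
Qed.

Lemma map_lift_enum T n (l : 'I_n.+1 -> T) (j : 'I_n.+1) :
  let W := [seq l i | i <- enum 'I_n.+1] in
  [seq l (lift j i) | i <- enum 'I_n] = take j W ++ drop j.+1 W.
Proof.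
move=> W; have sW : size W = n.+1 by rewrite size_map size_enum_ord.
have jn := ltn_ord j; pose a := l j.
have WE (i : 'I_n.+1) : nth a W i = l i.
  by rewrite (nth_map j) ?size_enum_ord // nth_ord_enum.
apply: (@eq_from_nth _ a) => [|i].
  by rewrite size_map size_enum_ord size_cat size_takel ?size_drop sW; lia.
rewrite size_map size_enum_ord => ltin.
rewrite (nth_map (Ordinal ltin)) ?size_enum_ord // -WE.
rewrite (@nth_ord_enum _ _ (Ordinal ltin)) nth_cat size_takel; last by lia.
rewrite /= /bump; case: ltnP => ij; first by rewrite nth_take.
by rewrite nth_drop; congr nth; lia.
Qed.

(** The exponent sum of (n - i) dim a_i of the sign that relates an operation on
    [M] to the operation on the suspension of [M]. It turns the product of the
    signature with the Koszul sign into the Koszul sign of the shifted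
    degrees, and the signs of the A(infinity) relations into Koszul signs. *)
Fixpoint susp_sign w : bool :=
  if w is a :: w' then (odd (size w') && ~~ par a.1) (+) susp_sign w'
  else false.

Lemma susp_sign_cat u v : susp_sign (u ++ v) =
  susp_sign u (+) (odd (size v) && (odd (size u) (+) sg u)) (+) susp_sign v.
Proof.
elim: u => [|a u IH] /=; first by rewrite andbF.
rewrite IH size_cat oddD sg_cons.
by case: (susp_sign u); case: (susp_sign v); parity_cases.
Qed.

Lemma prod_par (I : Type) (r : seq I) (Q : pred I) (F : I -> int) (c : int) :
  \prod_(i <- r | Q i) (-1) ^ (c * F i) =
  (-1) ^+ (par c && par (\sum_(i <- r | Q i) F i)) :> K.
Proof.
elim: r => [|i r IH]; first by rewrite !big_nil andbF.
rewrite !big_cons; case: (Q i) => //; rewrite IH exprz_par -signr_addb.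
by congr (_ ^+ _); rewrite parM parD; parity_cases.
Qed.

Lemma sdeg_take a w j : (j <= size w)%N ->
  sdeg (take j w) = \sum_(i < j) (nth a w i).1.
Proof.
elim: w j => [|b w IH] [|j] //= jw; rewrite ?big_ord0 //.
by rewrite big_ord_recl /= IH.
Qed.

(** The shuffle permutations realise the recursive shuffle product: the value
    of the permutation at the first place selects the word which provides the
    first letter. [susp_sign] accounts for the change of degrees. *)
Lemma shuffle_sum V n k (l : 'I_n -> letter) (F : word -> V) : (k <= n)%N ->
  let W := [seq l i | i <- enum 'I_n] in
  \sum_(s : 'S_n | is_shuffle k s)
     ((-1) ^+ s * koszul_sign (fun i => (l i).1 + 1) s) *:
       F [seq l (s i) | i <- enum 'I_n] =
  (-1) ^+ susp_sign W *:
    sh (take k W) (drop k W) (fun w => (-1) ^+ susp_sign w *: F w).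
Proof.
elim: n k l F => [|n IH] k l F kn W.
  rewrite (big_pred1 1%g) => [|s]; last first.
    rewrite /=; have -> : s = 1%g by apply/permP => -[].
    by rewrite eqxx; apply/shuffleP => -[].
  rewrite /W enum_ord0; case: k kn => // _; rewrite /= sh0w !scale1r odd_perm1.
  by rewrite /koszul_sign big_ord0 mulr1 scale1r.
have sW : size W = n.+1 by rewrite size_map size_enum_ord.
(* the permutations with first value [j]; the signature contributes [odd j],
   and the letter [l j] moves past the letters before it *)
have step (j : 'I_n.+1) k' : (k' <= n)%N ->
    \sum_(s : 'S_n | is_shuffle k' s)
     ((-1) ^+ (lift_perm ord0 j s) *
        koszul_sign (fun i => (l i).1 + 1) (lift_perm ord0 j s)) *:
       F [seq l (lift_perm ord0 j s i) | i <- enum 'I_n.+1] =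
    (-1) ^+ (odd j (+) (~~ par (l j).1 && (odd j (+) sg (take j W)))
       (+) (odd n && ~~ par (l j).1) (+) susp_sign (take j W ++ drop j.+1 W)) *:
    sh (take k' (take j W ++ drop j.+1 W)) (drop k' (take j W ++ drop j.+1 W))
      (fun w => (-1) ^+ susp_sign (l j :: w) *: F (l j :: w)).
  move=> k'n; have jW : (j <= size W)%N by rewrite sW ltnW.
  have WE (i : 'I_n.+1) : nth (l j) W i = l i.
    by rewrite (nth_map j) ?size_enum_ord // nth_ord_enum.
  have sgj : par (\sum_(i < n.+1 | (i < j)%N) ((l i).1 + 1)) =
      odd j (+) sg (take j W).
    rewrite big_split /= parD /sg (sdeg_take (l j) jW) addbC; congr (_ (+) _).
      by rewrite -(big_ord_widen _ (fun=> 1) (ltnW (ltn_ord j))) sumr_const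
        card_ord natz.
    rewrite (big_ord_widen _ (fun i => (nth (l j) W i).1) (ltnW (ltn_ord j))).
    by congr par; apply: eq_bigr => i _; rewrite WE.
  have := IH k' (fun i => l (lift j i)) (fun w => F (l j :: w)) k'n.
  rewrite map_lift_enum -/W => IHj.
  rewrite (eq_sh (F' := fun w => (-1) ^+ (odd n && ~~ par (l j).1) *:
    ((-1) ^+ susp_sign w *: F (l j :: w)))); last first.
    move=> w _; rewrite -size_cat cat_take_drop size_cat.
    rewrite size_takel // size_drop.
    rewrite sW => swn /=; rewrite scalerA -signr_addb.
    by have -> : size w = n by have := ltn_ord j; lia.
  rewrite shZ scalerA -signr_addb addbAC addbK.
  rewrite signr_addb -scalerA -IHj scaler_sumr; apply: eq_bigr => s _.
  rewrite scalerA; congr (_ *: F _).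
    rewrite odd_lift_perm koszul_lift prod_par sgj parD addbT !signr_addb.
    by rewrite expr0 mul1r mulrACA.
  rewrite enum_ordSl /= lift_perm_id -map_comp; congr (_ :: _).
  by apply: eq_map => i /=; rewrite lift_perm_lift.
pose T (j : 'I_n.+1) k' := \sum_(s : 'S_n | is_shuffle k' s)
   ((-1) ^+ (lift_perm ord0 j s) *
      koszul_sign (fun i => (l i).1 + 1) (lift_perm ord0 j s)) *:
     F [seq l (lift_perm ord0 j s i) | i <- enum 'I_n.+1].
have split_j j : \sum_(s : 'S_n | is_shuffle k (lift_perm ord0 j s))
     ((-1) ^+ (lift_perm ord0 j s) *
        koszul_sign (fun i => (l i).1 + 1) (lift_perm ord0 j s)) *:
       F [seq l (lift_perm ord0 j s i) | i <- enum 'I_n.+1] =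
    (if (j == ord0) && (0 < k)%N then T j k.-1 else 0) +
    (if j == k :> nat then T j k else 0).
  rewrite (eq_bigl _ _ (fun s => shuffle_lift k j s)).
  have [/andP[/eqP -> k0]|N] := boolP ((j == ord0) && (0 < k)%N).
    rewrite /= ltn_eqF // addr0.
    by apply: eq_bigl => s; rewrite orbF.
  rewrite /= add0r.
  by case: eqP => // _; rewrite big_pred0.
rewrite sum_perm_lift (eq_bigr _ (fun j _ => split_j j)) big_split /=.
rewrite -!big_mkcond /= big_mkcondr big_pred1_eq.
have WE : W = l ord0 :: drop 1 W by rewrite /W enum_ordSl /= drop0.
have sWE : susp_sign W = (odd n && ~~ par (l ord0).1) (+) susp_sign (drop 1 W).
  by rewrite {1}WE /= size_drop sW subSS subn0.
have T0 k' : (k' <= n)%N -> T ord0 k' = (-1) ^+ susp_sign W *: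
    sh (take k' (drop 1 W)) (drop k' (drop 1 W))
      (fun w => (-1) ^+ susp_sign (l ord0 :: w) *: F (l ord0 :: w)).
  move=> k'n; rewrite /T step // take0 /=.
  by rewrite andbF sWE.
case: k kn split_j => [|k] kn _ /=.
  rewrite add0r (big_pred1 ord0) => [|j] //.
  by rewrite T0 // !take0 !drop0 !sh0w -WE.
rewrite T0 //.
have tW : take k.+1 W = l ord0 :: take k (drop 1 W) by rewrite {1}WE.
have dW : drop k.+1 W = drop k (drop 1 W) by rewrite {1}WE.
rewrite -dW; have [kn1|kn1] := ltnP k.+1 n.+1; last first.
  rewrite big_pred0 ?addr0 => [|j]; last by apply/eqP; have := ltn_ord j; lia.
  by rewrite (@drop_oversize _ k.+1) ?sW // !shw0 -tW.
pose j := Ordinal kn1; rewrite (big_pred1 j) => [|i] //.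
rewrite /T step //= take_size_cat ?drop_size_cat ?size_takel ?sW //.
have djW : drop k.+1 W = l j :: drop k.+2 W.
  rewrite (drop_nth (l j)) ?sW //; congr (_ :: _).
  by rewrite (nth_map j) ?size_enum_ord // (nth_ord_enum _ j).
rewrite djW tW sh_cons -tW scalerDr scalerA -signr_addb.
congr (_ + _ ^+ _ *: _).
have : size (take k.+1 W) = k.+1 by rewrite size_takel // sW.
have : size (drop k.+2 W) = (n - k.+1)%N by rewrite size_drop sW subSS.
have -> : susp_sign W = susp_sign (take k.+1 W ++ l j :: drop k.+2 W).
  by rewrite -djW cat_take_drop.
move: (take k.+1 W) (drop k.+2 W) => X Y sY sX.
rewrite !susp_sign_cat /= sX sY.
have -> : odd n = odd (n - k.+1) (+) ~~ odd k.
  by rewrite -[in LHS](subnK (kn1 : k < n)%N) oddD.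
by case: (susp_sign X); case: (susp_sign Y); rewrite /= ?sY; parity_cases.
Qed.
End ShufflePerm.

(** * Multilinear maps and homogeneous components *)

Section Multilinear.
Context {K : fieldType} {M : gradedModule K}.
Implicit Types (V : lmodType K).

Definition seq_multilin V (F : seq M -> V) : Prop :=
  forall u t, is_lin (fun z => F (u ++ z :: t)).

Lemma ev_tuple n (f : tmap M M n) (x : n.-tuple M) : ev f x = f x.
Proof. by rewrite /ev valK. Qed.

Lemma ev_size n (f : tmap M M n) x : size x != n -> ev f x = 0.
Proof. by move=> sx; rewrite /ev insubF // (negPf sx). Qed.

Lemma val_upd n (x : n.-tuple M) (i : 'I_n) z :
  upd x i z = take i x ++ z :: drop i.+1 x :> seq M.
Proof.
have szi : size (take i x) = i by rewrite size_takel // size_tuple ltnW.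
apply: (@eq_from_nth _ 0) => [|j].
  by rewrite size_tuple size_cat szi /= size_drop size_tuple; have := ltn_ord i;
    lia.
rewrite size_tuple => jn; rewrite -(tnth_nth _ _ (Ordinal jn)) tnth_mktuple.
rewrite nth_cat szi -val_eqE /=; case: ltngtP => ij.
- by rewrite (tnth_nth 0) nth_take.
- rewrite (tnth_nth 0) /= -[(j - i)%N]prednK ?subn_gt0 //= nth_drop.
  by congr nth; lia.
- by rewrite ij subnn.
Qed.

Lemma ev_seq_multilin n (f : tmap M M n) : multilinear f -> seq_multilin (ev f).
Proof.
move=> fm u t c z1 z2.
have [sn|sn] := eqVneq (size (u ++ z1 :: t)) n; last first.
  by rewrite !ev_size ?scaler0 ?addr0 //; rewrite !size_cat /= in sn *.
have un : (size u < n)%N by rewrite -sn size_cat /=; lia.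
pose x : n.-tuple M := Tuple (introT eqP sn).
have E z : ev f (u ++ z :: t) = f (upd x (Ordinal un) z).
  rewrite -ev_tuple val_upd /= take_size_cat //.
  by rewrite -[X in drop _ X]cat_rcons drop_size_cat ?size_rcons.
by rewrite !E fm.
Qed.

Lemma seq_multilin_multilinear n (F : seq M -> M) :
  seq_multilin F -> multilinear (fun x : n.-tuple M => F x).
Proof. by move=> Fl x i c z1 z2; rewrite !val_upd; apply: Fl. Qed.

Lemma seq_multilin_cons V z (F : seq M -> V) : seq_multilin F ->
  seq_multilin (fun x => F (z :: x)).
Proof. by move=> Fl u t; apply: Fl (z :: u) t. Qed.

(** Linear maps given on the components of [M] add up to a linear map on [M]:
    components outside [gsupp z] vanish, so that any larger finite set of
    degrees gives the same sum. *)
Definition hsum V (g : int -> M -> V) (z : M) : V :=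
  \sum_(q <- gsupp z) g q (hpart M q z).

Lemma gsuppP (z : M) : uniq (gsupp z) /\ z = \sum_(q <- gsupp z) hpart M q z.
Proof. by have /andP[u /eqP] := xchooseP (hpart_sum z). Qed.

Lemma hpart_out (z : M) q : q \notin gsupp z -> hpart M q z = 0.
Proof.
move=> qz; rewrite [z in LHS](gsuppP z).2 linear_sum big_seq big1 // => p pz.
by rewrite hpart_orth ifN //; apply: contraNneq qz => ->.
Qed.

Lemma hsumE V (g : int -> M -> V) z (s : seq int) :
  (forall q, g q 0 = 0) -> uniq s -> {subset gsupp z <= s} ->
  hsum g z = \sum_(q <- s) g q (hpart M q z).
Proof.
move=> g0 us zs; rewrite /hsum [RHS](bigID (mem (gsupp z))) /=.
rewrite [X in _ + X]big1 => [|q /hpart_out ->]; last exact: g0.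
rewrite addr0 -[RHS]big_filter; apply: perm_big; apply: uniq_perm.
- exact: (gsuppP z).1.
- exact: filter_uniq.
- move=> q; rewrite mem_filter.
  by have [/zs ->|] := boolP (q \in gsupp z); rewrite ?andbT.
Qed.

Lemma hsum_lin V (g : int -> M -> V) :
  (forall q, is_lin (g q)) -> is_lin (hsum g).
Proof.
move=> gl c z1 z2; have g0 q : g q 0 = 0 by apply: is_lin0.
pose s := undup (gsupp z1 ++ gsupp z2 ++ gsupp (c *: z1 + z2)).
have sub z : z \in [:: z1; z2; c *: z1 + z2] -> {subset gsupp z <= s}.
  by move=> zz q qz; rewrite mem_undup !mem_cat; move: zz; rewrite !inE
    => /or3P[] /eqP <-; rewrite qz ?orbT.
rewrite !(@hsumE _ _ _ s) ?undup_uniq //; try by apply: sub;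
  rewrite !inE eqxx ?orbT.
rewrite scaler_sumr -big_split /=; apply: eq_bigr => q _.
by rewrite linearP gl.
Qed.

Lemma hsum_homog V (g : int -> M -> V) q z :
  (forall q, g q 0 = 0) -> homog q z -> hsum g z = g q z.
Proof.
move=> g0 hz; rewrite (@hsumE _ _ _ (undup (q :: gsupp z))) ?undup_uniq //.
  rewrite (bigD1_seq q) ?undup_uniq ?mem_undup ?inE ?eqxx //= hz.
  rewrite big1 ?addr0 // => p pq.
  by rewrite -hz hpart_orth (negPf pq) g0.
by move=> p pz; rewrite mem_undup inE pz orbT.
Qed.

Lemma twist_lin k : is_lin (@twist K M k).
Proof.
by apply: (@hsum_lin _ (fun q z => (-1) ^ (k * q) *: z)) => q; apply: is_linZl.
Qed.

Lemma twist0 (z : M) : twist 0 z = z.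
Proof.
rewrite [RHS](gsuppP z).2; apply: eq_bigr => q _.
by rewrite mul0r expr0z scale1r.
Qed.

Lemma seq_multilin_insert n s (h : tmap M M n) (g : tmap M M s) r k :
  multilinear h -> multilinear g ->
    seq_multilin (fun x => ev h (insert r k g x)).
Proof.
move=> hm gm u t c z1 z2; rewrite /insert.
have hl := ev_seq_multilin hm; have gl := ev_seq_multilin gm.
have [ur|ru] := ltnP (size u) r.
  have E z : take r (u ++ z :: t) = u ++ z :: take (r - size u).-1 t.
    rewrite take_cat ltnNge ltnW //=; congr (_ ++ _).
    by case: (r - size u)%N (subn_gt0 (size u) r) => [|m]; rewrite ?ur.
  have D m z : drop (r + m) (u ++ z :: t) = drop (r + m - size u).-1 t.
    rewrite drop_cat ifF; last by lia.
    by case: (r + m - size u)%N (subn_gt0 (size u) (r + m)) => [|j] //=; lia.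
  have D0 z : drop r (u ++ z :: t) = drop (r - size u).-1 t.
    by have := D 0%N z; rewrite addn0.
  by rewrite !E !D !D0 !map_cat /= -!catA /= twist_lin hl.
have [urs|rsu] := ltnP (size u) (r + s).
  have E z : take r (u ++ z :: t) = take r u by rewrite takel_cat.
  have D z : drop (r + s) (u ++ z :: t) = drop (r + s - size u).-1 t.
    rewrite drop_cat ifF; last by lia.
    by case: (r + s - size u)%N (subn_gt0 (size u) (r + s)) => [|j] //=; lia.
  have G z : take s (drop r (u ++ z :: t)) =
      drop r u ++ z :: take (s - (size u - r)).-1 t.
    rewrite drop_cat; case: ltnP => ru'.
      rewrite take_cat size_drop ifF; last by lia.
      case: (s - (size u - r))%N (subn_gt0 (size u - r) s) => [|j] //; lia.
    have -> : (r - size u = 0)%N by lia.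
    rewrite drop0 drop_oversize //=.
    have -> : (size u - r = 0)%N by lia.
    by rewrite subn0; case: (s) urs => //; lia.
  by rewrite !E !D !G gl hl.
have E z : take r (u ++ z :: t) = take r u by rewrite takel_cat.
have G z : take s (drop r (u ++ z :: t)) = take s (drop r u).
  rewrite drop_cat; case: ltnP => ru'.
    by rewrite takel_cat // size_drop; lia.
  have -> : s = 0%N by lia.
  by rewrite !take0.
have D z : drop (r + s) (u ++ z :: t) = drop (r + s) u ++ z :: t.
  rewrite drop_cat; case: ltnP => // rs'.
  have -> : (r + s - size u = 0)%N by lia.
  by rewrite drop0 drop_oversize.
by rewrite !E !G !D -!(cat_cons _ _ (_ :: t)) !catA hl.
Qed.

End Multilinear.

(** * Suspension of graded multilinear maps *)

Section Suspension.
Context {K : fieldType} {M : gradedModule K}.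
Local Notation word := (@word K M).
Local Notation letter := (@letter K M).
Implicit Types (u v w x y t : word) (a b : letter) (V : lmodType K).

(** Taking the component in the labelled degree makes every function of words
    built from a multilinear map depend on the homogeneous parts only, so that
    identities between such functions hold for all words. *)
Definition letval a : M := hpart M (a.1 + 1) a.2.

Lemma letval_homog a : homog (a.1 + 1) (letval a).
Proof. by rewrite /homog /letval hpart_orth eqxx. Qed.

Lemma letval_id q (z : M) : homog q z -> letval (q - 1, z) = z.
Proof. by rewrite /letval /= subrK. Qed.

Lemma letval_lin e : is_lin (fun z => letval (e, z)).
Proof. by move=> c z1 z2; rewrite /letval linearP. Qed.

Definition suspend n (f : tmap M M n) w : M :=
  (-1) ^+ susp_sign w *: ev f (map letval w).

Lemma susp_sign_slot u e (z z' : M) t : susp_sign (u ++ (e, z) :: t) =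
  susp_sign (u ++ (e, z') :: t).
Proof. by rewrite !susp_sign_cat. Qed.

Lemma word_multilin_suspend n (f : tmap M M n) : multilinear f ->
  word_multilin (suspend f).
Proof.
move=> fm u e t c z1 z2; rewrite /suspend !map_cat /= letval_lin
  (ev_seq_multilin fm).
rewrite (susp_sign_slot u e _ 0) (susp_sign_slot u e z1 0)
  (susp_sign_slot u e z2 0).
by rewrite scalerDr !scalerA mulrC.
Qed.

Lemma suspend_size n (f : tmap M M n) w : size w != n -> suspend f w = 0.
Proof. by move=> sw; rewrite /suspend ev_size ?scaler0 // size_map. Qed.

Lemma homogZ q c (z : M) : homog q z -> homog q (c *: z).
Proof. by rewrite /homog linearZ /= => ->. Qed.

Lemma homogD q (z1 z2 : M) : homog q z1 -> homog q z2 -> homog q (z1 + z2).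
Proof. by rewrite /homog linearD /= => -> ->. Qed.

Lemma homog0 q : homog q (0 : M).
Proof. by rewrite /homog linear0. Qed.

Lemma sdegE w : sdeg w = \sum_(a <- w) a.1.
Proof. by elim: w => [|a w IH]; rewrite ?big_nil // big_cons /= IH. Qed.

Lemma suspend_homog n k (f : tmap M M n) w : has_degree k f ->
  homog (sdeg w + n%:Z + k) (suspend f w).
Proof.
move=> fd; have [sw|/suspend_size ->] := eqVneq (size w) n; last exact: homog0.
subst n; apply: homogZ;
  rewrite -[map letval w]/(val (map_tuple letval (in_tuple w))).
rewrite ev_tuple.
have -> : sdeg w + (size w)%:Z = \sum_(i < size w)
  ((tnth (in_tuple w) i).1 + 1).
  rewrite big_split /= sumr_const card_ord natz sdegE; congr (_ + _).
  by rewrite (big_tnth _ _ w).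
by apply: fd => i; rewrite tnth_map; apply: letval_homog.
Qed.

(** Each argument is a sum of homogeneous elements. *)
Lemma seq_multilin_word V (F : seq M -> V) n : seq_multilin F ->
  (forall w, size w = n -> F (map letval w) = 0) ->
  forall x : seq M, size x = n -> F x = 0.
Proof.
elim: n F => [|n IH] F Fl F0 x sx.
  by rewrite (size0nil sx) -[[::]]/(map letval [::]); apply: F0.
case: x sx => [|z x] //= [sx].
have Fz : is_lin (fun z => F (z :: x)) by apply: (Fl [::]).
rewrite (gsuppP z).2; elim: (gsupp z) => [|q s IHs].
  by rewrite big_nil (is_lin0 Fz).
rewrite big_cons (is_linD _ _ Fz) IHs addr0.
apply: (IH (fun x : seq M => F (hpart M q z :: x))) => // [|w sw].
  exact: seq_multilin_cons.
have <- : letval (q - 1, hpart M q z) = hpart M q z.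
  by apply: letval_id; rewrite /homog hpart_orth eqxx.
by apply: (F0 (_ :: w)); rewrite /= sw.
Qed.

Definition hword n (d : 'I_n -> int) (x : n.-tuple M) : word :=
  [seq (d i - 1, tnth x i) | i <- enum 'I_n].

Lemma map_hword n (d : 'I_n -> int) (x : n.-tuple M) (g : letter -> M) :
  (forall i, g (d i - 1, tnth x i) = tnth x i) -> map g (hword d x) = x.
Proof.
move=> gx; rewrite -map_comp (eq_map (g := tnth x)) //.
by rewrite -[RHS]map_tnth_enum.
Qed.

Lemma sdeg_hword n (d : 'I_n -> int) (x : n.-tuple M) :
  sdeg (hword d x) + n%:Z = \sum_i d i.
Proof.
rewrite sdegE big_map big_enum /= big_split /= sumrN sumr_const card_ord.
by rewrite natz subrK.
Qed.

(** Up to an overall sign, each generator of the shuffle submodule is a shuffle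
    product of two nonempty words. *)
Lemma vanish_ShP n (f : tmap M M n) :
  vanish_Sh f <->
  (forall x y, (0 < size x)%N -> (0 < size y)%N -> sh x y (suspend f) = 0).
Proof.
have evE (l : 'I_n -> letter) (s : 'S_n) (a : n.-tuple M) :
    (forall i, tnth a i = letval (l i)) ->
    ev f (map letval [seq l (s i) | i <- enum 'I_n]) =
      f [tuple tnth a (s i) | i < n].
  move=> al; rewrite -ev_tuple /= -map_comp; congr ev.
  by apply: eq_map => i; rewrite al.
split=> [fs x y x0 y0|fs k d a kn ad].
  have [sxy|sxy] := eqVneq (size x + size y)%N n; last first.
    rewrite (eq_sh (F' := fun _ => 0 *: 0)) ?shZ ?scale0r //.
    by move=> w _ sw; rewrite suspend_size ?scaler0 // sw.
  have w0 : letter by case: x x0 {sxy}.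
  pose l i := nth w0 (x ++ y) (val (i : 'I_n)).
  pose a := [tuple letval (l i) | i < n].
  have kn : (1 <= size x <= n.-1)%N by rewrite x0 -sxy; lia.
  have := fs (size x) (fun i => (l i).1 + 1) a kn.
  rewrite (eq_bigr (fun s : 'S_n => ((-1) ^+ s *
      koszul_sign (fun i => (l i).1 + 1) s) *:
      ev f (map letval [seq l (s i) | i <- enum 'I_n]))); last first.
    by move=> s _; rewrite (evE _ _ a) // => i; rewrite tnth_mktuple.
  rewrite (@shuffle_sum _ _ _ n (size x) l (fun w => ev f (map letval w)));
    last by lia.
  have -> : [seq l i | i <- enum 'I_n] = x ++ y.
    apply: (@eq_from_nth _ w0); rewrite size_map size_enum_ord ?size_cat // =>
      i ltin.
    rewrite (nth_map (Ordinal ltin)) ?size_enum_ord //.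
    by rewrite (nth_ord_enum _ (Ordinal ltin)).
  rewrite take_size_cat // drop_size_cat // => H.
  have /eqP := H (fun i => ltac:(rewrite tnth_mktuple; exact: letval_homog)).
  by rewrite scaler_eq0 signr_eq0 /= => /eqP.
pose l i : letter := (d i - 1, tnth a i).
rewrite (eq_bigr (fun s : 'S_n => ((-1) ^+ s *
    koszul_sign (fun i => (l i).1 + 1) s) *:
    ev f (map letval [seq l (s i) | i <- enum 'I_n]))); last first.
  move=> s _; rewrite (evE _ _ a) => [|i]; last by rewrite /l letval_id.
  congr (_ * _ *: _); rewrite /koszul_sign.
  by apply: eq_bigr => i _; apply: eq_bigr => j _; rewrite /l /= !subrK.
rewrite (@shuffle_sum _ _ _ n k l (fun w => ev f (map letval w))); last by lia.
set W := map _ _; have sW : size W = n by rewrite size_map size_enum_ord.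
rewrite fs ?scaler0 //; last by rewrite size_drop sW; lia.
by rewrite size_takel ?sW; lia.
Qed.

(** Inverse to [suspend] up to sign; it makes a cochain of the curvature, which
    is only given as a function of words. *)
Fixpoint extend_homog V (F : word -> V) (x : seq M) : V :=
  if x is z :: x' then
    hsum (fun q z => extend_homog (fun w => F ((q - 1, z) :: w)) x') z
  else F [::].

Lemma eq_extend_homog V (F F' : word -> V) (x : seq M) :
  (forall w, size w = size x -> F w = F' w) ->
  extend_homog F x = extend_homog F' x.
Proof.
elim: x F F' => [|z x IH] F F' eF /=; first exact: eF.
by apply: eq_bigr => q _; apply: IH => w sw; apply: eF; rewrite /= sw.
Qed.

Lemma extend_homog_lin V (F F' : word -> V) c (x : seq M) :
  extend_homog (fun w => c *: F w + F' w) x =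
  c *: extend_homog F x + extend_homog F' x.
Proof.
elim: x F F' => [|z x IH] F F' //=.
by rewrite /hsum scaler_sumr -big_split; apply: eq_bigr => q _; rewrite IH.
Qed.

Lemma extend_homog_slot V (F : word -> V) (x : seq M) q : word_multilin F ->
  is_lin (fun z => extend_homog (fun w => F ((q - 1, z) :: w)) x).
Proof.
move=> Fm c z1 z2; rewrite -extend_homog_lin; apply: eq_extend_homog => w _.
exact: word_multilin_head.
Qed.

Lemma seq_multilin_extend_homog V (F : word -> V) : word_multilin F ->
  seq_multilin (extend_homog F).
Proof.
move=> Fm u t c z1 z2; elim: u F Fm => [|z u IH] F Fm /=.
  by apply: (hsum_lin
    (g := fun q z => extend_homog (fun w => F ((q - 1, z) :: w)) t))
    => q; apply: extend_homog_slot.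
rewrite /hsum scaler_sumr -big_split; apply: eq_bigr => q _ /=.
by apply: IH; apply: word_multilin_cons.
Qed.

Lemma extend_homog_word V (F : word -> V) w : word_multilin F ->
  (forall a, a \in w -> homog (a.1 + 1) a.2) ->
  extend_homog F (map snd w) = F w.
Proof.
elim: w F => [|a w IH] F Fm hw //=.
rewrite (@hsum_homog _ _ _ _ (a.1 + 1)) => [|q|]; last 2 first.
- exact: (is_lin0 (extend_homog_slot (map snd w) q Fm)).
- by apply: hw; rewrite inE eqxx.
rewrite addrK -surjective_pairing IH //; first exact: word_multilin_cons.
by move=> b bw; apply: hw; rewrite inE bw orbT.
Qed.

End Suspension.

(** * The A(infinity) relations and the Hochschild coboundary on words *)

Section Conversion.
Context {K : fieldType} {M : gradedModule K}.
Local Notation word := (@word K M).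
Local Notation letter := (@letter K M).
Implicit Types (u v w x y t : word) (a b : letter) (V : lmodType K).

(** An A(infinity) structure or morphism as one function on the tensor
    coalgebra of the suspension: the corestriction of the associated
    coderivation or coalgebra morphism. *)
Definition suspend_seq (p : tseq M M) w : M :=
  if w is [::] then 0 else suspend (p (size w)) w.

Lemma suspend_seqE p w :
  (0 < size w)%N -> suspend_seq p w = suspend (p (size w)) w.
Proof. by case: w. Qed.

Lemma word_multilin_suspend_seq p :
  (forall i, (1 <= i)%N -> multilinear (p i)) -> word_multilin (suspend_seq p).
Proof.
move=> pm u e t c z1 z2.
have E z : suspend_seq p (u ++ (e, z) :: t) =
    suspend (p (size u + (size t).+1)%N) (u ++ (e, z) :: t).
  by rewrite suspend_seqE size_cat //= addnS.
by rewrite !E word_multilin_suspend //; apply: pm; rewrite addnS.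
Qed.

Lemma suspend_seq_homog c p w :
  (forall i, (1 <= i)%N -> has_degree (c - i%:Z) (p i)) ->
  homog (sdeg w + c) (suspend_seq p w).
Proof.
case: w => [|a w] pd; first exact: homog0.
have := suspend_homog (a :: w) (pd (size (a :: w)) isT).
by rewrite addrA addrAC addrK.
Qed.

Lemma sh_suspend_seq p : (forall i, (1 <= i)%N -> vanish_Sh (p i)) ->
  forall x y, (0 < size x)%N -> (0 < size y)%N -> sh x y (suspend_seq p) = 0.
Proof.
move=> pv x y x0 y0.
have sxy : (1 <= size x + size y)%N by lia.
rewrite -((vanish_ShP _).1 (pv _ sxy) x y x0 y0).
by apply: eq_sh => w _ sw; rewrite suspend_seqE sw.
Qed.

Lemma letval_opletter (B : word -> M) v :
  homog (sdeg v + 2) (B v) -> letval (opletter B v) = B v.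
Proof. by rewrite /homog /letval /opletter /= -addrA. Qed.

Lemma twist_word k u (R : seq M) V (F : seq M -> V) : seq_multilin F ->
  F (map (twist k) (map letval u) ++ R) =
  (-1) ^+ (par k && (sg u (+) odd (size u))) *: F (map letval u ++ R).
Proof.
elim: u F => [|a u IH] F Fl /=; first by rewrite andbF scale1r.
rewrite (IH (fun R : seq M => F (twist k (letval a) :: R)));
  last exact: seq_multilin_cons.
rewrite (twist_homog k (letval_homog a))
  (is_linZ _ _ (Fl [::] (map letval u ++ R))).
rewrite scalerA exprz_par -signr_addb parM parD sg_cons.
by congr (_ ^+ _ *: _); parity_cases.
Qed.

(** After suspension all signs of [insert] reduce to the one of a degree-one
    operation that moves past [u]. *)
Lemma insert_suspend n s k (h : tmap M M n) (g : tmap M M s) u v t :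
  multilinear h -> has_degree k g -> k = 2 - s%:Z -> size v = s ->
  ev h (insert (size u) k g (map letval (u ++ v ++ t))) =
  (-1) ^+ (odd (size u + s * size t) (+) sg u (+) susp_sign (u ++ v ++ t)) *:
    suspend h (u ++ opletter (suspend g) v :: t).
Proof.
move=> hm gd ks sv; have hl := ev_seq_multilin hm.
have pk : par k = odd s by rewrite ks parD parN.
rewrite /insert !map_cat take_size_cat ?size_map // drop_size_cat ?size_map //.
rewrite take_size_cat ?size_map // catA drop_size_cat; last first.
  by rewrite size_cat !size_map sv.
rewrite twist_word // /suspend map_cat /= letval_opletter; last first.
  have := suspend_homog v gd; rewrite ks.
  by rewrite -addrA [s%:Z + _]addrC subrK.
rewrite /suspend (is_linZ _ _ (hl _ _)) !scalerA -!signr_addb.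
congr (_ ^+ _ *: _); rewrite !susp_sign_cat /= !size_cat /= pk.
rewrite /opletter /= parD -/(sg v) sv !oddD oddM.
change (par 1) with true.
by case: (susp_sign u); case: (susp_sign v); case: (susp_sign t); parity_cases.
Qed.

Lemma coder_sum B V w (F : word -> V) :
  coder B w F = \sum_(r < size w) \sum_(s < size w - r)
    (-1) ^+ sg (take r w) *:
    F (take r w ++ opletter B (take s.+1 (drop r w)) :: drop (r + s.+1) w).
Proof.
elim: w F => [|a w IH] F; first by rewrite big_ord0.
rewrite big_ord_recl [LHS]/= splits_sum; congr (_ + _).
  by apply: eq_bigr => i _; rewrite scale1r.
rewrite IH scaler_sumr; apply: eq_bigr => r _; rewrite scaler_sumr.
apply: eq_bigr => s _.
by rewrite scalerA -signr_addb -sg_cons.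
Qed.

(** For [p = m] the relations of an A(infinity) structure become
    [coder B w B = 0]; in general this is one side of the morphism relations. *)
Lemma insert_sum_coder (p m : tseq M M) n (x : n.-tuple M) w :
  (forall i, (1 <= i)%N -> multilinear (p i)) ->
  (forall i, (1 <= i)%N -> has_degree (2 - i%:Z) (m i)) ->
  map letval w = x ->
  insert_sum p m x =
  (-1) ^+ susp_sign w *: coder (suspend_seq m) w (suspend_seq p).
Proof.
move=> pm md wx.
have sw : size w = n by rewrite -(size_map letval) wx size_tuple.
rewrite coder_sum scaler_sumr /insert_sum big_ord_recr /= [X in _ + X]big1;
  last first.
  move=> s _; apply: big1 => t; lia.
rewrite addr0 sw; apply: eq_bigr => r _; rewrite scaler_sumr.
rewrite big_ord_recl /= [X in X + _]big1 ?add0r; last by move=> t; lia.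
rewrite (big_ord_widen n
  (fun s => (-1) ^+ susp_sign w *: ((-1) ^+ sg (take r w) *:
  suspend_seq p (take r w ++ opletter (suspend_seq m) (take s.+1 (drop r w)) ::
    drop (r + s.+1) w))));
  last by lia.
rewrite [RHS]big_mkcond; apply: eq_bigr => s _.
have [srn|srn] := ltnP s (n - r); last by rewrite big1 // => t; rewrite /bump;
  lia.
have tn : (n - r - s.+1 < n.+1)%N by lia.
rewrite (big_pred1 (Ordinal tn)) /= => [|t]; last first.
  by rewrite -[RHS]val_eqE /= /bump; lia.
rewrite /bump add1n -wx.
pose u := take r w; pose v := take s.+1 (drop r w); pose t := drop (r + s.+1) w.
have su : size u = r by rewrite size_takel // sw; lia.
have sv : size v = s.+1 by rewrite size_takel // size_drop sw; lia.
have st : size t = (n - r - s.+1)%N by rewrite size_drop sw; lia.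
have wE : w = u ++ v ++ t.
  by rewrite /t addnC -drop_drop cat_take_drop cat_take_drop.
have := @insert_suspend _ s.+1 _ (p (r + 1 + (n - r - s.+1))%N) (m s.+1) u v t
  (pm _ _) (md _ _) erefl sv.
rewrite -wE su st => -> //; last by lia.
rewrite scalerA -signr_odd -signr_addb !addbA addbb addFb addbC signr_addb
  -scalerA.
congr (_ *: (_ *: _)).
rewrite -/u -/v -/t /opletter [suspend_seq m v]suspend_seqE ?sv // suspend_seqE;
  last by rewrite size_cat /=; lia.
by rewrite size_cat /= su st addn1 addSnnS.
Qed.

Lemma susp_sign_catC u v : susp_sign (u ++ v) =
  susp_sign u (+) susp_sign v (+) (odd (size v) && (sg u (+) odd (size u))).
Proof. by rewrite susp_sign_cat [sg u (+) _]addbC addbAC. Qed.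

Definition mul2 (mu : tmap M M 2) (z1 z2 : M) : M := mu [tuple z1; z2].

Lemma ev_mul2 (mu : tmap M M 2) z1 z2 : ev mu [:: z1; z2] = mul2 mu z1 z2.
Proof. exact: (ev_tuple mu [tuple z1; z2]). Qed.

Lemma mul2_linl (mu : tmap M M 2) z : multilinear mu ->
  is_lin (fun z1 => mul2 mu z1 z).
Proof.
by move=> hm c z1 z2; rewrite -!ev_mul2 (ev_seq_multilin hm [::] [:: z]).
Qed.

Lemma mul2_linr (mu : tmap M M 2) z : multilinear mu -> is_lin (mul2 mu z).
Proof.
by move=> hm c z1 z2; rewrite -!ev_mul2 (ev_seq_multilin hm [:: z] [::]).
Qed.

Lemma suspend2 (mu : tmap M M 2) a b :
  suspend mu [:: a; b] = (-1) ^+ (~~ par a.1) *: mul2 mu (letval a) (letval b).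
Proof. by rewrite /suspend ev_mul2 /= addbF. Qed.

(** The Hochschild coboundary after suspension. By [suspend_homog], [k + n] is
    the degree of [suspend f] as a function of words, whence the sign of the
    last term. *)
Lemma hdelta_word (mu : tmap M M 2) n k (f : tmap M M n) (x : n.+1.-tuple M)
    a v u b :
  multilinear mu -> has_degree 0 mu -> multilinear f ->
  a :: v = u ++ [:: b] -> map letval (a :: v) = x ->
  hdelta mu k f x = - (-1) ^+ susp_sign (a :: v) *:
    (contract (suspend mu) (a :: v) (suspend f)
     + (-1) ^+ sg u *: mul2 mu (suspend f u) (letval b)
     - (-1) ^+ ((par k (+) odd n) && ~~ par a.1) *:
         mul2 mu (letval a) (suspend f v)).
Proof.
move=> mm md fm avub avx.
have sav : size (a :: v) = n.+1 by rewrite -(size_map letval) avx size_tuple.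
have sv : size v = n by case: sav.
have su : size u = n by move: sav; rewrite avub size_cat addn1 => -[].
have mid : \sum_(i < n) (-1) ^+ i.+1 *: ev f (insert i 0 mu x) =
    - ((-1) ^+ susp_sign (a :: v) *:
         contract (suspend mu) (a :: v) (suspend f)).
  rewrite contract_sum scaler_sumr -sumrN sav; apply: eq_bigr => i _.
  pose u' := take i (a :: v); pose v' := take 2 (drop i (a :: v)).
  pose t' := drop i.+2 (a :: v); have ltin := ltn_ord i.
  have su' : size u' = i by rewrite size_takel // sav; lia.
  have sv' : size v' = 2 by rewrite size_takel // size_drop sav; lia.
  have wE : a :: v = u' ++ v' ++ t'.
    by rewrite /t' -[i.+2]/(2 + i)%N -drop_drop cat_take_drop cat_take_drop.
  have := @insert_suspend _ 2 0 f mu u' v' t' fm md erefl sv'.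
  rewrite -wE su' avx => ->.
  rewrite -/u' -/v' -/t'; move: (suspend f _) => L.
  rewrite -signr_odd !scalerA -signr_addb -scaleNr -[in RHS]signr_addb -signrN.
  congr (_ ^+ _ *: _); rewrite oddD oddM /= addbF.
  by case: (susp_sign v); parity_cases.
have fst : ev mu (insert 1 k f x) = (-1) ^+ susp_sign (a :: v) *:
    ((-1) ^+ ((par k (+) odd n) && ~~ par a.1) *:
       mul2 mu (letval a) (suspend f v)).
  rewrite -avx /insert /= take0 drop0 take_oversize ?size_map ?sv //.
  rewrite drop_oversize ?size_map ?sv // ev_mul2.
  rewrite (twist_homog k (letval_homog a)) (is_linZ _ _ (mul2_linl _ mm)).
  rewrite (is_linZ _ _ (mul2_linr _ mm)) !scalerA exprz_par -!signr_addb parM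
    parD.
  by congr (_ ^+ _ *: _); case: (susp_sign v); parity_cases.
have lst : (-1) ^+ n.+1 *: ev mu (insert 0 k f x) =
  - ((-1) ^+ susp_sign (a :: v) *:
    ((-1) ^+ sg u *: mul2 mu (suspend f u) (letval b))).
  rewrite -avx avub /insert /= take0 drop0 add0n map_cat /=.
  rewrite take_size_cat ?size_map // drop_size_cat ?size_map // ev_mul2.
  rewrite (is_linZ _ _ (mul2_linl _ mm)) !scalerA -signr_odd -!signr_addb
    -scaleNr.
  rewrite -signrN susp_sign_cat /= su.
  by congr (_ ^+ _ *: _); case: (susp_sign u); parity_cases.
rewrite /hdelta fst mid lst scaleNr; move: (contract _ _ _) => Q.
by rewrite scalerBr scalerDr opprB opprD addrA.
Qed.

End Conversion.

(** * Morphisms to a structure with a single binary operation *)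

Section TensorSum.
Context {K : fieldType} {M : gradedModule K}.
Local Notation word := (@word K M).
Local Notation letter := (@letter K M).
Implicit Types (u v w : word) (a b : letter) (V : lmodType K).
Variable mu : tmap M M 2.
Hypothesis mm : multilinear mu.

Let e (i : nat) : int := 1 - i%:Z.

Lemma ev_trivial (j : nat) xs :
  j != 2%N -> ev (@trivial_Ainfty K M mu j) xs = 0.
Proof. by rewrite /ev; case: insub => // x; case: j x => [|[|[|j]]]. Qed.

(** Only the binary operation of the target is nonzero, and a composition of
    [n] into two parts is determined by its first part. *)
Lemma tensor_sumE (p : tseq M M) n (x : n.-tuple M) :
  tensor_sum p (trivial_Ainfty mu) x =
  \sum_(i < n.+1 | (0 < i < n)%N) (-1) ^+ i.-1 *:
     ev mu (tensor p e [:: val i; (n - i)%N] x).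
Proof.
rewrite /tensor_sum.
have [n1|n1] := ltnP 1 n; last first.
  rewrite big_nat big1 => [|u /andP[u1 un]]; last first.
    by apply: big1 => ks _; rewrite ev_trivial ?scaler0 //; lia.
  by rewrite big1 // => i; lia.
rewrite big_ltn ?ltnS 1?ltnW // big1 ?add0r => [|ks _]; last first.
  by rewrite ev_trivial ?scaler0.
rewrite big_ltn ?ltnS //= [X in _ + X]big_nat [X in _ + X]big1 ?addr0;
  last first.
  by move=> u /andP[u1 un]; apply: big1 => ks _; rewrite ev_trivial ?scaler0 //;
    lia.
rewrite (reindex_onto (fun i : 'I_n.+1 => [tuple i; rev_ord i])
  (fun ks => tnth ks ord0)) /=; last first.
  move=> ks; rewrite !big_ord_recl big_ord0 addn0 => /andP[_ /eqP s].
  apply/eq_from_tnth => i; case: (unliftP ord0 i) => [j|] -> //.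
  have -> : j = ord0 by apply: ord1.
  by rewrite [LHS]/tnth /=; apply: val_inj => /=; lia.
apply: eq_big => [i|i _].
  rewrite !big_ord_recl big_ord0 addn0.
  apply/andP/idP => [[/andP[/forallP H _] _]|H].
    have := H ord0; have := H (lift ord0 ord0); rewrite !(tnth_nth ord0) /=;
      lia.
  have ltin := ltn_ord i; split; last by rewrite (tnth_nth ord0).
  apply/andP; split; last by rewrite !(tnth_nth ord0) /=; lia.
  apply/forallP => j; case: (unliftP ord0 j) => [k|] ->;
    rewrite !(tnth_nth ord0) /=.
    have -> : k = ord0 by apply: ord1.
    by rewrite /=; lia.
  by lia.
rewrite !big_ord_recl big_ord0 addn0 !(tnth_nth ord0) /= mul1n mul0n addn0
  subSS.
by rewrite subn1.
Qed.

(** For a target with a single binary operation, the right-hand side of the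
    morphism relation is a convolution square. Together with
    [insert_sum_coder], this identifies morphisms with twisting cochains. *)
Lemma tensor_sum_cup (p : tseq M M) n (x : n.-tuple M) w :
  (forall i, (1 <= i)%N -> multilinear (p i)) ->
  map letval w = x ->
  tensor_sum p (trivial_Ainfty mu) x =
  - (-1) ^+ susp_sign w *: cup (mul2 mu) (suspend_seq p) (suspend_seq p) w.
Proof.
move=> pm wx; have sw : size w = n by rewrite -(size_map letval) wx size_tuple.
rewrite tensor_sumE /cup splits_sum sw scaler_sumr
  [RHS](bigID (fun i : 'I_n.+1 => (0 < i < n)%N)) /=.
rewrite [X in _ + X]big1 ?addr0 => [|i ni]; last first.
  have [i0|i0] := posnP i; first by rewrite i0 take0 (is_lin0 (mul2_linl _ mm))
    !scaler0.
  have -> : i = n :> nat by have := ltn_ord i; lia.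
  by rewrite drop_oversize ?sw // (is_lin0 (mul2_linr _ mm)) !scaler0.
apply: eq_bigr => i /andP[i0 iN].
pose u := take i w; pose v := drop i w.
have su : size u = i by rewrite size_takel // sw ltnW.
have sv : size v = (n - i)%N by rewrite size_drop sw.
have wuv : w = u ++ v by rewrite cat_take_drop.
rewrite -wx /= wuv map_cat take_size_cat ?size_map // drop_size_cat ?size_map
  //.
rewrite take_oversize ?size_map ?sv //.
have tw0 : map (twist (\sum_(j <- [::]) e j)) (map letval v) = map letval v.
  by rewrite big_nil -[RHS]map_id; apply: eq_map => z; apply: twist0.
rewrite tw0 big_seq1 take_size_cat // drop_size_cat // ev_mul2.
have pi := ev_seq_multilin (pm _ i0); have i0' : (1 <= n - i)%N by lia.
have := twist_word (e (n - i)%N) u [::] pi; rewrite !cats0 => ->.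
rewrite !suspend_seqE ?su ?sv // /suspend.
rewrite (is_linZ _ _ (mul2_linl _ mm)) (is_linZ _ _ (mul2_linl _ mm)).
rewrite (is_linZ _ _ (mul2_linr _ mm)) !scalerA -signr_odd -!signr_addb -signrN.
rewrite -!signr_addb; congr (_ ^+ _ *: _).
rewrite susp_sign_catC su sv /e parD parN /=.
have -> : odd i.-1 = ~~ odd i by case: (val i) i0 => //= m _; rewrite negbK.
change (par 1) with true; rewrite par_nat.
by case: (susp_sign u); case: (susp_sign v); parity_cases.
Qed.

Lemma tensor2_slot (p : tseq M M) i j (u t : seq M) :
  (forall i, (1 <= i)%N -> multilinear (p i)) -> (0 < i)%N -> (0 < j)%N ->
  (size u + size t).+1 = (i + j)%N ->
  is_lin (fun z => ev mu (tensor p e [:: i; j] (u ++ z :: t))).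
Proof.
move=> pm i0 j0 sut c z1 z2 /=; rewrite !ev_mul2.
have pi := ev_seq_multilin (pm _ i0); have pj := ev_seq_multilin (pm _ j0).
have [ui|iu] := ltnP (size u) i.
  have E z : take i (u ++ z :: t) = u ++ z :: take (i - size u).-1 t.
    rewrite take_cat ltnNge ltnW //=; congr (_ ++ _).
    by case: (i - size u)%N (subn_gt0 (size u) i) => [|k]; rewrite ?ui.
  have D z : drop i (u ++ z :: t) = drop (i - size u).-1 t.
    rewrite drop_cat ltnNge ltnW //=.
    by case: (i - size u)%N (subn_gt0 (size u) i) => [|k]; rewrite ?ui.
  by rewrite !E !D !map_cat /= twist_lin pi mul2_linl.
have E z : take i (u ++ z :: t) = take i u by rewrite takel_cat.
have D z : take j (drop i (u ++ z :: t)) = drop i u ++ z :: t.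
  rewrite take_oversize ?size_drop ?size_cat /=; last by lia.
  rewrite drop_cat; case: ltnP => // ui; have -> : i = size u by lia.
  by rewrite subnn drop0 drop_size.
by rewrite !E !D !map_cat /= twist_lin pj mul2_linr.
Qed.

(** Both sides of the morphism relation are multilinear. *)
Lemma morphism_homog (p m : tseq M M) n :
  (forall i, (1 <= i)%N -> multilinear (p i)) ->
  (forall i, (1 <= i)%N -> multilinear (m i)) ->
  (forall w, size w = n -> forall x : n.-tuple M, map letval w = x ->
     insert_sum p m x = tensor_sum p (trivial_Ainfty mu) x) ->
  forall x : n.-tuple M, insert_sum p m x = tensor_sum p (trivial_Ainfty mu) x.
Proof.
move=> pm mm' H.
pose L (x : seq M) : M := \sum_(r < n.+1) \sum_(s < n.+1)
    \sum_(t < n.+1 | ((r + s + t == n) && (1 <= s))%N)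
      (-1) ^+ (r + s * t) *: ev (p (r + 1 + t)%N) (insert r (2 - s%:Z) (m s) x).
pose R (x : seq M) : M := \sum_(i < n.+1 | (0 < i < n)%N) (-1) ^+ i.-1 *:
     ev mu (tensor p e [:: val i; (n - i)%N] x).
(* on lists of other lengths [R] ignores some arguments, so it is not
   multilinear there *)
pose F x := if size x == n then L x - R x else 0.
have Fl : seq_multilin F.
  move=> u t c z1 z2; rewrite /F !size_cat /=.
  case: eqP => [sut|]; last by rewrite scaler0 addr0.
  rewrite addnS in sut.
  have -> : L (u ++ (c *: z1 + z2) :: t) = c *: L (u ++ z1 :: t) +
    L (u ++ z2 :: t).
    rewrite /L; do 2 (rewrite scaler_sumr -big_split; apply: eq_bigr => ? _ /=).
    rewrite scaler_sumr -big_split; apply: eq_bigr => t' /andP[_ s1] /=.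
    rewrite seq_multilin_insert; [|by apply: pm; lia | exact: mm'].
    by rewrite scalerDr !scalerA mulrC.
  have -> : R (u ++ (c *: z1 + z2) :: t) = c *: R (u ++ z1 :: t) +
    R (u ++ z2 :: t).
    rewrite /R scaler_sumr -big_split; apply: eq_bigr => i /andP[i0 iN] /=.
    rewrite tensor2_slot //; try lia.
    by rewrite scalerDr !scalerA mulrC.
  by rewrite scalerBr opprD addrACA.
have F0 x : size x = n -> F x = 0.
  apply: (seq_multilin_word Fl) => w sw;
    have swt : size (map letval w) == n by rewrite size_map sw.
  have E : L (map letval w) = R (map letval w).
    by have := H w sw (Tuple swt) erefl; rewrite tensor_sumE.
  by rewrite /F E subrr if_same.
move=> x; have := F0 x (size_tuple x); rewrite /F size_tuple eqxx => /eqP.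
by rewrite subr_eq0 tensor_sumE => /eqP.
Qed.

End TensorSum.

(** * Degrees and supports *)

Section Support.
Context {K : fieldType} {M : gradedModule K}.
Local Notation word := (@word K M).
Local Notation letter := (@letter K M).
Implicit Types (u v w x y : word) (a b : letter) (V : lmodType K).

Lemma splits_first_letter V a v (G : word -> word -> V) :
  G [::] (a :: v) = 0 ->
  (forall x y, x ++ y = v -> (0 < size x)%N -> G (a :: x) y = 0) ->
  splits (a :: v) G = G [:: a] v.
Proof.
move=> G0 G1 /=; rewrite G0 add0r.
case: v {G0} G1 => [|b v] G1 //=; rewrite splits0 ?addr0 // => x y xy.
by apply: G1; rewrite //= xy.
Qed.

Lemma splits_last_letter V u b (G : word -> word -> V) :
  G (u ++ [:: b]) [::] = 0 ->
  (forall x y, x ++ y = u -> (0 < size y)%N -> G x (y ++ [:: b]) = 0) ->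
  splits (u ++ [:: b]) G = G u [:: b].
Proof.
elim: u G => [|a u IH] G G0 G1 /=; first by rewrite G0 addr0.
rewrite (G1 [::] (a :: u)) // add0r IH // => x y xy y0.
by apply: G1; rewrite //= xy.
Qed.

Lemma splits_map V (f : letter -> letter) w (G : word -> word -> V) :
  splits (map f w) G = splits w (fun u v => G (map f u) (map f v)).
Proof. by elim: w G => [|a w IH] G //=; rewrite IH. Qed.

Lemma splits_homog q w (G : word -> word -> M) :
  (forall u v, u ++ v = w -> homog q (G u v)) -> homog q (splits w G).
Proof.
elim: w G => [|a w IH] G Gq /=; first exact: Gq.
by apply: homogD; [apply: Gq|apply: IH => u v uv; apply: Gq; rewrite /= uv].
Qed.

Lemma coder_homog B q w (F : word -> M) :
  (forall z, sdeg z = sdeg w + 1 -> homog q (F z)) -> homog q (coder B w F).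
Proof.
elim: w F => [|a w IH] F Fq /=; first exact: homog0.
apply: homogD.
  by apply: splits_homog => u v uv; apply: Fq;
    rewrite /= -uv sdeg_cat addrAC !addrA.
by apply: homogZ; apply: IH => z dz; apply: Fq; rewrite /= dz addrA.
Qed.

Lemma eq_contract V B B' w (F F' : word -> V) :
  (forall a b, B [:: a; b] = B' [:: a; b]) ->
  (forall z, size z = (size w).-1 -> F z = F' z) ->
  contract B w F = contract B' w F'.
Proof.
move=> eB; elim: w F F' => [|a w IH] F F' eF //.
case: w IH eF => [|b w] IH eF //.
rewrite !contract_cons /opletter eB eF //; congr (_ + _ *: _).
by apply: IH => z /= sz; apply: eF; rewrite /= sz.
Qed.

Definition hletter a : letter := (a.1, letval a).

Lemma letval_hletter a : letval (hletter a) = letval a.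
Proof. by rewrite /letval /hletter /= hpart_orth eqxx. Qed.

Lemma map_letval_hletter w : map letval (map hletter w) = map letval w.
Proof. by rewrite -map_comp; apply: eq_map => a; rewrite /= letval_hletter. Qed.

Lemma sdeg_hletter w : sdeg (map hletter w) = sdeg w.
Proof. by elim: w => //= a w ->. Qed.

Lemma susp_sign_hletter w : susp_sign (map hletter w) = susp_sign w.
Proof. by elim: w => //= a w ->; rewrite size_map. Qed.

Lemma suspend_seq_hletter p w : suspend_seq p (map hletter w) = suspend_seq p w.
Proof.
case: w => // a w; rewrite !suspend_seqE // size_map.
by rewrite /suspend map_letval_hletter susp_sign_hletter.
Qed.

(** Used to show that the curvature, like the suspended maps it is made of,
    only depends on the components in the labelled degrees. *)
Lemma coder_hletter B w (F : word -> M) :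
  (forall w, B (map hletter w) = B w) ->
  (forall v, letval (opletter B v) = B v) ->
  (forall w, F (map hletter w) = F w) ->
  coder B (map hletter w) F = coder B w F.
Proof.
move=> Bp Bh; elim: w F => [|a w IH] F Fp //=.
have Fa z : F (hletter a :: z) = F (a :: z).
  by rewrite -[LHS]Fp -[RHS]Fp /= /hletter letval_hletter.
congr (_ + _ *: _); last first.
  rewrite IH => [|z]; last by rewrite !Fa -Fp -[RHS]Fp /= -!map_comp;
    congr (F (_ :: _)); apply: eq_map => b; rewrite /= /hletter letval_hletter.
  by apply: eq_coder => z _ _; apply: Fa.
rewrite splits_map; apply: eq_splits => u v _.
have -> : opletter B (hletter a :: map hletter u) = opletter B (a :: u).
  by rewrite -[hletter a :: _]/(map hletter (a :: u)) /opletter Bp sdeg_hletter.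
by rewrite -[RHS]Fp /= {2}/hletter Bh.
Qed.

End Support.

(** * Obstruction theory for twisting cochains *)

Section Obstruction.
Context {K : fieldType} {M : gradedModule K}.
Local Notation word := (@word K M).
Local Notation letter := (@letter K M).
Implicit Types (u v w : word) (a b : letter).
Variable mu : tmap M M 2.
Hypothesis hmu : graded_comm_algebra mu.
Hypothesis hHarr : forall n : nat, (3 <= n)%N -> harr_vanishes mu n (2 - n%:Z).
Variable B : word -> M.
Hypothesis Bm : word_multilin B.
Hypothesis BB : forall w, coder B w B = 0.
Hypothesis B0 : B [::] = 0.
Hypothesis B1 : forall a, B [:: a] = 0.
Hypothesis B2 : forall a b, B [:: a; b] = suspend mu [:: a; b].
Hypothesis Bsh : forall x y : word, (0 < size x)%N -> (0 < size y)%N ->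
  sh x y B = 0.
Hypothesis Bh : forall w, homog (sdeg w + 2) (B w).
Hypothesis Bp : forall w, B (map hletter w) = B w.

Let mul := mul2 mu.
Let mm : multilinear mu. Proof. by case: hmu => -[]. Qed.
Let mull z : is_lin (fun z1 => mul z1 z). Proof. exact: mul2_linl. Qed.
Let mulr z : is_lin (mul z). Proof. exact: mul2_linr. Qed.

Lemma mul_assoc z1 z2 z3 : mul (mul z1 z2) z3 = mul z1 (mul z2 z3).
Proof. by case: hmu => _ /(_ z1 z2 z3). Qed.

Lemma mul_homog q1 q2 z1 z2 : homog q1 z1 -> homog q2 z2 ->
  homog (q1 + q2) (mul z1 z2).
Proof.
move=> h1 h2; case: hmu => -[_ md] _ _.
have := md (fun i => if i == ord0 then q1 else q2) [tuple z1; z2].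
rewrite !big_ord_recl big_ord0 addr0 addr0 /=; apply => i.
case: (unliftP ord0 i) => [j|] ->; rewrite (tnth_nth 0) //=.
by have -> : j = ord0 by apply: ord1.
Qed.

(** Candidates for the morphism to the trivial structure: everything except
    the morphism relations. *)
Definition comm_cochains (p : tseq M M) : Prop :=
  (forall i, (1 <= i)%N -> ghom (1 - i%:Z) (p i) /\ vanish_Sh (p i)) /\
  (forall z : M, p 1%N [tuple z] = z).

(** By [insert_sum_coder] and [tensor_sum_cup], these are the morphism
    relations for fewer than [N] arguments. *)
Definition flat (N : nat) (p : tseq M M) : Prop :=
  forall w, (size w < N)%N -> curv mul B (suspend_seq p) w = 0.

Lemma suspend_seq1 (p : tseq M M) a : comm_cochains p -> suspend_seq p [:: a] =
  letval a.
Proof.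
move=> [_ p1]; rewrite /suspend_seq /suspend /= scale1r.
by rewrite -[RHS]p1 -(ev_tuple (p 1%N)).
Qed.

Section Curv.
Variable p : tseq M M.
Arguments p : clear implicits.
Hypothesis hp : comm_cochains p.
Local Notation P := (suspend_seq p).
Local Notation R := (curv mul B P).

Let pm i : (1 <= i)%N -> multilinear (p i).
Proof. by move=> i1; case: (hp.1 i i1) => -[]. Qed.

Let Pm : word_multilin P. Proof. exact: word_multilin_suspend_seq. Qed.

Let Ph w : homog (sdeg w + 1) (P w).
Proof. by apply: suspend_seq_homog => i i1; case: (hp.1 i i1) => -[]. Qed.

Let RM : word_multilin R. Proof. by apply: word_multilin_curv. Qed.

(** With two arguments the relation says that the identity is multiplicative. *)
Lemma flat3 : flat 3 p.
Proof.
move=> w w3; rewrite /curv coder_contract //; last first.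
  by case: w w3 => [|a [|b [|c w]]] //= _ [|d z].
have P1 a : suspend (p 1%N) [:: a] = letval a by apply: suspend_seq1.
have zl z : mul 0 z = 0 by apply: is_lin0 (mull z).
have zr z : mul z 0 = 0 by apply: is_lin0 (mulr z).
case: w w3 => [|a [|b [|c w]]] //= _;
  rewrite /cup /= ?zl ?zr ?scaler0 ?addr0 ?add0r // ?scaler0 ?addr0 //.
rewrite !P1 letval_opletter // B2 suspend2 sg_cons addbF -scalerDl.
by case: (par a.1); rewrite ?addNr ?subrr ?expr0 ?expr1 ?subrr ?addNr scale0r.
Qed.

Lemma curv_homog w : homog (sdeg w + 2) (R w).
Proof.
apply: homogD.
  by apply: coder_homog => z dz; have := Ph z; rewrite dz -addrA.
apply: splits_homog => u v <-; apply: homogZ.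
rewrite sdeg_cat -[2]/(1 + 1) addrACA.
exact: mul_homog.
Qed.

Lemma curv_hletter w : R (map hletter w) = R w.
Proof.
rewrite /curv coder_hletter //; last 2 first.
- by move=> v; apply: letval_opletter.
- exact: suspend_seq_hletter.
congr (_ + _); rewrite /cup splits_map; apply: eq_splits => u v _.
by rewrite !suspend_seq_hletter /sg sdeg_hletter.
Qed.

Lemma curv_sh (x y : word) : (0 < size x)%N -> (0 < size y)%N -> sh x y R = 0.
Proof.
apply: curv_shuffle => //.
  by apply: sh_suspend_seq => i i1; case: (hp.1 i i1).
move=> u v; case: hmu => _ _ /(_ _ _ _ _ (Ph u) (Ph v)).
rewrite /mul /mul2 => ->.
by rewrite exprz_par parM !parD !addbT.
Qed.

Variable n : nat.
Hypothesis flat_n : flat n.+1 p.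

(** The lowest component of the curvature; the sign undoes that of
    [suspend]. *)
Definition obstruction : tmap M M n.+1 := fun x =>
  extend_homog (fun w => (-1) ^+ susp_sign w *: R w) x.

Let Sm : word_multilin (fun w => (-1) ^+ susp_sign w *: R w).
Proof.
move=> u e t c z1 z2; rewrite RM scalerDr !scalerA mulrC.
by rewrite (susp_sign_slot u e _ 0) (susp_sign_slot u e z1 0)
  (susp_sign_slot u e z2 0).
Qed.

Lemma suspend_obstruction w : size w = n.+1 -> suspend obstruction w = R w.
Proof.
move=> sw; pose x := Tuple (introT eqP (etrans (size_map letval w) sw)).
rewrite /suspend -[map letval w]/(val x) ev_tuple /obstruction /=.
have -> : map letval w = map snd (map hletter w) by rewrite -map_comp.
rewrite extend_homog_word // => [|a /mapP[b _ ->]]; last exact: letval_homog.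
by rewrite susp_sign_hletter curv_hletter scalerA -signr_addb addbb scale1r.
Qed.

Lemma obstruction_ghom : ghom (2 - n.+1%:Z) obstruction.
Proof.
split=> [|d x dx];
  first exact/seq_multilin_multilinear/seq_multilin_extend_homog.
have xE : map snd (hword d x) = x by apply: map_hword.
rewrite /obstruction -xE extend_homog_word //; last first.
  by move=> a /mapP[i _ ->]; rewrite /= subrK; apply: dx.
apply: homogZ; rewrite -(sdeg_hword d x).
by rewrite addrA addrAC addrK; apply: curv_homog.
Qed.

Lemma obstruction_vanish : vanish_Sh obstruction.
Proof.
apply/vanish_ShP => x y x0 y0.
have [sxy|sxy] := eqVneq (size x + size y)%N n.+1.
  rewrite -(curv_sh x0 y0); apply: eq_sh => w _ sw.
  by rewrite suspend_obstruction // sw.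
rewrite (eq_sh (F' := fun _ => 0 *: 0)) ?shZ ?scale0r //.
by move=> w _ sw; rewrite suspend_size ?scaler0 // sw.
Qed.

(** In the Bianchi identity for words of length [n.+2], the vanishing of
    the curvature on words of length at most [n] leaves exactly the terms of the
    Hochschild coboundary of its component of length [n.+1]. *)
Lemma obstruction_cocycle : hdelta mu (2 - n.+1%:Z) obstruction =1 (fun _ => 0).
Proof.
set k := 2 - _.
pose F (x : seq M) : M := ev mu (insert 1 k obstruction x)
  + \sum_(i < n.+1) (-1) ^+ i.+1 *: ev obstruction (insert i 0 mu x)
  + (-1) ^+ n.+2 *: ev mu (insert 0 k obstruction x).
have om : multilinear obstruction := obstruction_ghom.1.
have Fl : seq_multilin F.
  move=> u t c z1 z2; rewrite /F !seq_multilin_insert //.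
  under eq_bigr => i _ do rewrite seq_multilin_insert // scalerDr scalerA mulrC
    -scalerA.
  rewrite big_split /= -scaler_sumr !scalerDr !scalerA [_ * c]mulrC.
  by rewrite [RHS]addrACA; congr (_ + _); rewrite addrACA.
suff F0 x : size x = n.+2 -> F x = 0 by move=> x; apply: F0; rewrite size_tuple.
apply: (seq_multilin_word Fl) => -[//|a v] sw.
pose xt := Tuple (introT eqP (etrans (size_map letval (a :: v)) sw)).
rewrite -[F _]/(hdelta mu k obstruction xt).
have [u [b avub]] : exists u b, a :: v = u ++ [:: b].
  by exists (belast a v), (last a v); rewrite lastI cats1.
have su : size u = n.+1 by have := sw; rewrite avub size_cat addn1 => -[].
have sv : size v = n.+1 by have [] := sw.
have md : has_degree 0 mu by case: hmu => -[].
rewrite (@hdelta_word _ _ mu _ k obstruction xt a v u b) //.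
have kn : par k (+) odd n.+1 = false by rewrite /k parD parN par_nat addbb.
rewrite kn andFb expr0 scale1r !suspend_obstruction //
  (eq_contract (B' := B) (F' := R)); first last.
- by move=> z; rewrite /= sv => sz; apply: suspend_obstruction.
- by move=> a' b'; rewrite B2.
rewrite -coder_contract //; last first.
  by move=> z /=; rewrite sv => sz; apply: flat_n.
have := bianchi mul_assoc mull mulr BB Pm (a :: v).
have -> : cup mul R P (a :: v) = (-1) ^+ sg u *: mul (R u) (letval b).
  rewrite /cup avub splits_last_letter ?suspend_seq1 //.
    by rewrite (is_lin0 (mulr _)) scaler0.
  move=> x1 x2 x12 x20; rewrite flat_n ?(is_lin0 (mull _)) ?scaler0 //.
  by move: su; rewrite -x12 size_cat; lia.
rewrite splits_first_letter ?suspend_seq1 //; last 2 first.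
- by rewrite (is_lin0 (mull _)).
- move=> x1 x2 x12 x10; rewrite flat_n ?(is_lin0 (mulr _)) //.
  by move: sv; rewrite -x12 size_cat; lia.
by rewrite /mul => ->; rewrite scaler0.
Qed.

Hypothesis n2 : (2 <= n)%N.

(** The last three terms are the part of the curvature linear in [g] on words
    of length [n.+1]. Up to the sign of the suspension they are minus the
    Harrison coboundary of [g], and Harrison cohomology vanishes. *)
Lemma obstruction_coboundary :
  exists2 g : tmap M M n, harr_cochain (1 - n%:Z) g &
  forall w, size w = n.+1 -> R w + contract B w (suspend g) +
    cup mul P (suspend g) w + cup mul (suspend g) P w = 0.
Proof.
have [g gc gd] : harr_coboundary mu (2 - n.+1%:Z) obstruction.
  apply: hHarr => //; split; last exact: obstruction_cocycle.
  by split; [exact: obstruction_ghom|exact: obstruction_vanish].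
have kn : 2 - n.+1%:Z = 1 - n%:Z by lia.
rewrite kn in gc gd; exists g => // -[//|a v] sw.
pose x := Tuple (introT eqP (etrans (size_map letval (a :: v)) sw)).
rewrite -suspend_obstruction // {1}/suspend -[map letval (a :: v)]/(val x)
  ev_tuple gd.
have [u [b avub]] : exists u b, a :: v = u ++ [:: b].
  by exists (belast a v), (last a v); rewrite lastI cats1.
have su : size u = n by have := sw; rewrite avub size_cat addn1 => -[].
have sv : size v = n by have [] := sw.
have md : has_degree 0 mu by case: hmu => -[].
have gm : multilinear g by case: gc => -[].
rewrite (@hdelta_word _ _ mu _ _ g x a v u b) //.
have -> : par (1 - n%:Z) (+) odd n = true by rewrite parD parN par_nat addbK.
rewrite scalerA mulrN -signr_addb addbb scaleN1r andTb.
have G0 z : size z != n -> suspend g z = 0 by apply: suspend_size.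
have -> : cup mul P (suspend g) (a :: v) =
    (-1) ^+ par a.1 *: mul (letval a) (suspend g v).
  rewrite /cup splits_first_letter ?suspend_seq1 // ?sg_cons ?addbF //.
    by rewrite (is_lin0 (mull _)) scaler0.
  move=> x1 x2 x12 x10; rewrite G0 ?(is_lin0 (mulr _)) ?scaler0 //.
  by move: sv; rewrite -x12 size_cat; lia.
have -> : cup mul (suspend g) P (a :: v) =
    (-1) ^+ sg u *: mul (suspend g u) (letval b).
  rewrite /cup avub splits_last_letter ?suspend_seq1 //.
    by rewrite (is_lin0 (mulr _)) scaler0.
  move=> x1 x2 x12 x20; rewrite G0 ?(is_lin0 (mull _)) ?scaler0 //.
  by move: su; rewrite -x12 size_cat; lia.
rewrite (eq_contract (B' := B) (F' := suspend g)) //.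
rewrite signrN scaleNr opprK /mul.
move: (contract _ _ _) (_ *: mul2 mu (suspend g u) _)
  (_ *: mul2 mu (letval a) _).
move=> z1 z2 z3; rewrite -2!addrA [z3 + z2]addrC [z1 + (z2 + z3)]addrA addNr //.
Qed.

(** Since [ev g] vanishes on lists of any other length, this only changes the
    component [p n]. *)
Definition correction (g : tmap M M n) : tseq M M := fun i x => p i x + ev g x.

Lemma suspend_correction g w :
  suspend_seq (correction g) w = suspend_seq p w + suspend g w.
Proof.
case: w => [|a w]; first by rewrite suspend_size ?addr0 //= eq_sym -lt0n ltnW.
rewrite !suspend_seqE // /suspend -scalerDr; congr (_ *: _).
have sx : size (map letval (a :: w)) = size (a :: w) by rewrite size_map.
pose y : (size (a :: w)).-tuple M := Tuple (introT eqP sx).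
by rewrite -[map letval _]/(val y) !ev_tuple.
Qed.

Lemma correction_cochains g : harr_cochain (1 - n%:Z) g ->
  comm_cochains (correction g).
Proof.
move=> [[gm gd] gv]; have gl := ev_seq_multilin gm.
split=> [i i1|z]; last first.
  by rewrite /correction hp.2 ev_size ?addr0 //=; lia.
have [[pim pid] piv] := hp.1 i i1; split; first split.
- move=> x j c z1 z2; rewrite /correction pim !val_upd gl.
  by rewrite scalerDr addrACA.
- move=> d x dx; apply: homogD; first exact: pid.
  have [E|E] := eqVneq i n; last by rewrite ev_size ?size_tuple //;
    apply: homog0.
  by move: d x dx; rewrite E => d x dx; rewrite ev_tuple; apply: gd.
move=> k d a kn da; rewrite /correction.
under eq_bigr => s _ do rewrite scalerDr.
rewrite big_split /= piv // add0r.
have [E|E] := eqVneq i n; last first.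
  by rewrite big1 // => s _; rewrite ev_size ?scaler0 // size_map size_enum_ord.
move: d a kn da; rewrite E => d a kn da; rewrite -[RHS](gv k d a kn da).
by apply: eq_bigr => s _; rewrite -(ev_tuple g).
Qed.

(** The part of the curvature quadratic in [g] lives on words of length
    [2 * n], which is larger than [n.+1]; the linear part lives on words of
    length at least [n.+1], and in that length it cancels [R] by assumption. *)
Lemma flat_correction (g : tmap M M n) : multilinear g ->
  (forall w, size w = n.+1 -> R w + contract B w (suspend g) +
    cup mul P (suspend g) w + cup mul (suspend g) P w = 0) ->
  flat n.+2 (correction g).
Proof.
move=> gm gR w sw; pose G := suspend g.
have Gm : word_multilin G by apply: word_multilin_suspend.
have G0 z : size z != n -> G z = 0 by apply: suspend_size.
have cupGG : cup mul G G w = 0.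
  apply: splits0 => u v uv; have [su|su] := eqVneq (size u) n; last first.
    by rewrite G0 // (is_lin0 (mull _)) scaler0.
  rewrite (G0 v) ?(is_lin0 (mulr _)) ?scaler0 //.
  by move: sw; rewrite -uv size_cat su; lia.
have -> : curv mul B (suspend_seq (correction g)) w =
    R w + contract B w G + cup mul P G w + cup mul G P w.
  have eP z : suspend_seq (correction g) z = P z + G z.
    exact: suspend_correction.
  rewrite /curv (eq_coder _ (F' := fun z => P z + G z)); last by move=> z _ _.
  rewrite coderD (coder_contract B1 Gm); last by move=> z sz; apply: G0; lia.
  have -> :
      cup mul (suspend_seq (correction g)) (suspend_seq (correction g)) w =
      cup mul P P w + cup mul P G w + (cup mul G P w + cup mul G G w).
    rewrite /cup -!splitsD; apply: eq_splits => u v _; rewrite !eP.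
    by rewrite (is_linD _ _ (mull _)) !(is_linD _ _ (mulr _)) !scalerDr.
  by rewrite cupGG addr0 -!addrA; congr (_ + _); rewrite addrCA.
have [swn|swn] := eqVneq (size w) n.+1; first exact: gR.
have {swn}sw : (size w < n.+1)%N by lia.
rewrite flat_n // contract_eq0 => [|z sz]; last by apply: G0; lia.
rewrite !add0r /cup !splits0 ?addr0 // => u v uv.
  have [su|su] := eqVneq (size u) n;
    last by rewrite (G0 u) // (is_lin0 (mull _)) scaler0.
  have /size0nil -> : size v = 0%N by move: sw; rewrite -uv size_cat; lia.
  by rewrite (is_lin0 (mulr _)) scaler0.
have [sv|sv] := eqVneq (size v) n;
  last by rewrite (G0 v) // (is_lin0 (mulr _)) scaler0.
have /size0nil -> : size u = 0%N by move: sw; rewrite -uv size_cat; lia.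
by rewrite (is_lin0 (mull _)) scaler0.
Qed.

End Curv.

(** To make the relations hold for [N.+3] arguments too, it is enough to change
    the component of index [N.+2]; those of lower index are final. *)
Definition stage (N : nat) : Type :=
  {p : tseq M M | comm_cochains p /\ flat N.+3 p}.

Lemma next_ex N (s : stage N) : exists s' : stage N.+1,
  forall i, i != N.+2 -> sval s' i =1 sval s i.
Proof.
case: s => p [hp fp].
have [g gc gR] := obstruction_coboundary hp fp isT.
have gm : multilinear g by case: gc => -[].
exists (exist _ (correction p g)
  (conj (correction_cochains (n := N.+2) hp isT gc)
        (flat_correction (n := N.+2) fp isT gm gR))).
move=> i iN x /=; rewrite /correction ev_size ?addr0 //.
by rewrite size_tuple.
Qed.

Definition next N (s : stage N) : stage N.+1 :=
  sval (constructive_indefinite_description _ (next_ex s)).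

Lemma nextP N (s : stage N) i : i != N.+2 -> sval (next s) i =1 sval s i.
Proof. exact: (svalP (constructive_indefinite_description _ (next_ex s))). Qed.

Definition identity_tseq : tseq M M := fun i =>
  match i return tmap M M i with
  | 1 => fun x => thead x
  | _ => fun _ => 0
  end.

Lemma ghom_zero n k : ghom k (fun _ : n.-tuple M => 0 : M).
Proof.
by split=> [x i c z1 z2|d x _]; [rewrite scaler0 addr0|apply: homog0].
Qed.

Lemma vanish_Sh_zero n : vanish_Sh (fun _ : n.-tuple M => 0 : M).
Proof. by move=> k d a _ _; rewrite big1 // => s _; rewrite scaler0. Qed.

Lemma identity_cochains : comm_cochains identity_tseq.
Proof.
split=> [[|[|i]] // _|z]; last by rewrite /= theadE.
  split; first split; first 2 last.
  - by move=> k d a; lia.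
  - move=> x i c z1 z2; have -> : i = ord0 by apply: ord1.
    by rewrite /= /thead !tnth_mktuple eqxx.
  - move=> d x dx; rewrite subrr addr0 big_ord_recl big_ord0 addr0.
    exact: dx.
by split; [apply: ghom_zero|apply: vanish_Sh_zero].
Qed.

Fixpoint chain N : stage N :=
  if N is N'.+1 then next (chain N')
  else exist _ identity_tseq (conj identity_cochains (flat3 identity_cochains)).

(** The component of index [i] does not change after stage [i] ([chainE]). *)
Definition limit : tseq M M := fun i => sval (chain i) i.

Arguments limit : clear implicits.

Lemma chainE i N : (i <= N)%N -> sval (chain N) i =1 limit i.
Proof.
elim: N => [|N IH]; first by rewrite leqn0 => /eqP -> x.
rewrite leq_eqVlt => /predU1P[-> //|iN] x.
by rewrite /= nextP ?IH //; lia.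
Qed.

Lemma limit_cochains : comm_cochains limit.
Proof.
split=> [i i1|z]; first by have [[h _] _] := svalP (chain i); apply: h.
by have [[_ h] _] := svalP (chain 1); apply: h.
Qed.

(** On words of a given length the limit agrees with a stage that is flat
    beyond that length. *)
Lemma limit_flat w : curv mul B (suspend_seq limit) w = 0.
Proof.
have [_ fl] := svalP (chain (size w)).
have eP z : (size z <= size w)%N -> suspend_seq limit z =
  suspend_seq (sval (chain (size w))) z.
  case: z => // a z sz; rewrite !suspend_seqE // /suspend; congr (_ *: _).
  pose x := Tuple (introT eqP (size_map letval (a :: z))).
  by rewrite -[map letval _]/(val x) !ev_tuple chainE.
rewrite -[RHS](fl w); last by lia.
congr (_ + _); first by apply: eq_coder => z _ /andP[_ sz]; apply: eP.
apply: eq_splits => u v uv.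
by rewrite !eP // -uv size_cat; lia.
Qed.

Lemma flat_cochains_exist :
  exists p, comm_cochains p /\ forall w, curv mul B (suspend_seq p) w = 0.
Proof. by exists limit; split; [exact: limit_cochains|exact: limit_flat]. Qed.

End Obstruction.

(** * The trivial structure *)

Section Trivial.
Context {K : fieldType} {M : gradedModule K}.

Lemma ghom_trivial (mu : tmap M M 2) i : graded_comm_algebra mu ->
  ghom (2 - i%:Z) (@trivial_Ainfty K M mu i).
Proof.
case=> hm _ _; have [->|i2] := eqVneq i 2; first by rewrite subrr.
by case: i i2 => [|[|[|i]]] // _; apply: ghom_zero.
Qed.

(** All compositions of operations vanish except those of the product with
    itself, which cancel by associativity. *)
Lemma trivial_relation (mu : tmap M M 2) n (x : n.-tuple M) :
  graded_comm_algebra mu ->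
  insert_sum (trivial_Ainfty mu) (trivial_Ainfty mu) x = 0.
Proof.
move=> hmu; have [[mm _] assoc _] := hmu.
have term_eq0 r s t k : (r, s, t) \notin [:: (0, 2, 1); (1, 2, 0)]%N ->
    ev (@trivial_Ainfty K M mu (r + 1 + t)%N)
       (insert r k (@trivial_Ainfty K M mu s) x) = 0.
  move=> N; have [rt|rt] := eqVneq (r + 1 + t)%N 2; last exact: ev_trivial.
  have s2 : s != 2%N.
    apply: contraNneq N => ->; rewrite !inE.
    by have [[-> ->]|[-> ->]] : r = 0%N /\ t = 1%N \/ r = 1%N /\ t = 0%N by lia.
  rewrite rt /insert (ev_trivial _ _ s2).
  exact: (is_lin0 (ev_seq_multilin mm (map _ _) _)).
have [n3|n3] := eqVneq n 3; last first.
  rewrite /insert_sum big1 // => r _; apply: big1 => s _; apply: big1 => t.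
  move=> /andP[/eqP rst _]; rewrite term_eq0 ?scaler0 //.
  apply: contraNN n3; rewrite !inE => /orP[] /eqP[r0 s2 t0]; apply/eqP; lia.
move: x term_eq0; rewrite n3 => x term_eq0.
have sum3 (G : nat -> nat -> nat -> M) :
    (forall r s t, (r, s, t) \notin [:: (0, 2, 1); (1, 2, 0)]%N -> G r s t = 0)
      ->
    \sum_(r < 4) \sum_(s < 4) \sum_(t < 4 | ((r + s + t == 3) && (1 <= s))%N)
      G r s t = G 0%N 2%N 1%N + G 1%N 2%N 0%N.
  move=> G0; have inner (r : 'I_4) (t : 'I_4) :
      (r + t = 1)%N -> \sum_(s < 4)
        \sum_(t < 4 | ((r + s + t == 3) && (1 <= s))%N)
      G r s t = G r 2%N t.
    move=> rt; rewrite (bigD1 (Ordinal (isT : 2 < 4)%N)) //= [X in _ + X]big1.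
      rewrite addr0 (big_pred1 t) // => t'; rewrite andbT -[RHS]val_eqE /=.
      by apply/eqP/eqP; lia.
    move=> s s2; apply: big1 => t' _; apply: G0; rewrite !inE !xpair_eqE.
    by rewrite -val_eqE /= in s2; rewrite (negPf s2) !andbF.
  rewrite big_ord_recl (inner _ (Ordinal (isT : 1 < 4)%N)) //.
  rewrite big_ord_recl (inner _ (Ordinal (isT : 0 < 4)%N)) //.
  rewrite [X in _ + (_ + X)]big1 ?addr0 // => r _.
  by apply: big1 => s _; apply: big1 => t _; apply: G0.
rewrite /insert_sum (sum3 (fun r s t => (-1) ^+ (r + s * t) *:
  ev (@trivial_Ainfty K M mu (r + 1 + t)%N)
   (insert r (2 - s%:Z) (@trivial_Ainfty K M mu s) x))); last first.
  by move=> r s t /term_eq0 ->; rewrite scaler0.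
case: x term_eq0 => -[|a [|b [|c [|]]]] //= sx _.
rewrite /insert /= !ev_mul2 subrr twist0.
rewrite -[X in X *: _ + _]signr_odd -[X in _ + X *: _]signr_odd /=.
rewrite scale1r expr1 scaleN1r.
by rewrite /mul2 assoc subrr.
Qed.

End Trivial.

(** * Triviality of the structure *)

Theorem corollary6 (K : fieldType) (M : gradedModule K) (mu : tmap M M 2)
    (hmu : graded_comm_algebra mu)
    (hHarr : forall n : nat, (3 <= n)%N -> harr_vanishes mu n (2 - n%:Z))
    (m : tseq M M) (hm : comm_Ainfty m)
    (hm1 : forall x : 1.-tuple M, m 1%N x = 0)
    (hm2 : forall x : 2.-tuple M, m 2%N x = mu x) :
  comm_Ainfty_equiv mu m (trivial_Ainfty mu).
Proof.
have [[mgh mrel] msh] := hm.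
have mmul i : (1 <= i)%N -> multilinear (m i) by move=> /mgh[].
have mdeg i : (1 <= i)%N -> has_degree (2 - i%:Z) (m i) by move=> /mgh[].
have Bm : word_multilin (suspend_seq m) by apply: word_multilin_suspend_seq.
have BB w : coder (suspend_seq m) w (suspend_seq m) = 0.
  case: w => [//|a w].
  have := mrel _ (map_tuple letval (in_tuple (a :: w))) isT.
  rewrite (insert_sum_coder (w := a :: w)) // => /eqP.
  by rewrite scaler_eq0 signr_eq0 => /eqP.
have B1 a : suspend_seq m [:: a] = 0.
  by rewrite suspend_seqE // /suspend (ev_tuple _ [tuple letval a]) hm1 scaler0.
have B2 a b : suspend_seq m [:: a; b] = suspend mu [:: a; b].
  by rewrite suspend_seqE // /suspend !(ev_tuple _ [tuple letval a; letval b])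
    hm2.
have Bh w : homog (sdeg w + 2) (suspend_seq m w) by apply: suspend_seq_homog.
have [p [pc pflat]] := flat_cochains_exist hmu hHarr Bm BB erefl B1 B2
  (sh_suspend_seq msh) Bh (suspend_seq_hletter m).
have pmul i : (1 <= i)%N -> multilinear (p i) by move=> /pc.1[[]].
have mu_mul : multilinear mu by case: hmu => -[].
split; first by split.
  split=> //; split; first split.
  - by move=> i _; apply: ghom_trivial.
  - by move=> n x _; apply: trivial_relation.
  - move=> i _; have [->|i2] := eqVneq i 2; last first.
      by case: i i2 => [|[|[|i]]] // _; apply: vanish_Sh_zero.
    move=> k d a k1 da; rewrite -[RHS](msh 2%N isT k d a k1 da).
    by apply: eq_bigr => s _; rewrite hm2.
exists p; split; last exact: pc.2.
split; last by move=> i /pc.1[].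
split=> [i /pc.1[] //|n x _]; apply: morphism_homog => // w sw {}x wx.
rewrite (insert_sum_coder pmul mdeg wx) (tensor_sum_cup mu_mul pmul wx).
rewrite scaleNr -scalerN; congr (_ *: _).
by apply/eqP; rewrite -addr_eq0; apply/eqP; apply: pflat.
Qed.
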